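(* Let $M$ be a smooth manifold with a $C^{1,1}$ pseudo-Riemannian metric $g$ and let $p\in M$. Then there exist open neighborhoods $U$ of $0\in T_pM$ and $V$ of $p$ in $M$ such that $$\exp_p^g: U\to V$$ is a bi-Lipschitz homeomorphism.
   Context: A $C^{1,1}$ pseudo-Riemannian metric is a pseudo-Riemannian metric (symmetric, non-degenerate $(0,2)$-tensor field of constant, arbitrary signature) whose components in smooth charts are continuously differentiable with locally Lipschitz first derivatives. Its Christoffel symbols $\Gamma^k_{g,ij}$ are then locally Lipschitz functions, so the geodesic equation $\ddot c^k+\Gamma_{g,ij}^k(c)\dot c^i\dot c^j=0$ has unique local solutions. The exponential map at $p$ is $\exp_p^g(v):=c(1)$, where $c$ is the $g$-geodesic with $c(0)=p$, $\dot c(0)=v$, for all $v\in T_pM$ for which $c$ exists on $[0,1]$. A bi-Lipschitz homeomorphism $f:U\to V$ is a homeomorphism (in particular onto $V$) such that there are constants $c,C>0$ with $c\|u-v\|\le d(f(u),f(v))\le C\|u-v\|$ for all $u,v\in U$. Here $\|\cdot\|$ is any norm on the finite-dimensional vector space $T_pM$ and $d$ is the distance on $M$ induced by any fixed smooth background Riemannian metric (equivalently, since the statement is local, the Euclidean distance in a smooth chart around $p$). *)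

(* Defs.v *)
From HB Require Import structures.
From mathcomp Require Import all_boot all_order all_algebra.
From mathcomp Require Import all_classical all_reals all_analysis.
Set Implicit Arguments.
Unset Strict Implicit.
Unset Printing Implicit Defensive.
Import Order.TTheory GRing.Theory Num.Theory.
Import numFieldNormedType.Exports.
Local Open Scope classical_set_scope.
Local Open Scope ring_scope.

(* Meant for open A: in finite dimension, C^{k+1} on A means differentiable on
   A with every directional derivative x |-> 'd f x v of class C^k on A. *)
Fixpoint Ck_on (R : realType) (n : nat) (W : normedModType R) (k : nat)
    (A : set 'rV[R]_n) (f : 'rV[R]_n -> W) : Prop :=
  if k is k'.+1 then
    (forall x, A x -> differentiable f x) /\
    (forall v, Ck_on k' A (fun x => 'd f x v))
  else forall x, A x -> {for x, continuous f}.

Definition smooth_on (R : realType) (n : nat) (W : normedModType R)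
    (A : set 'rV[R]_n) (f : 'rV[R]_n -> W) : Prop :=
  forall k, Ck_on k A f.

Definition C11_on (R : realType) (n : nat) (A : set 'rV[R]_n)
    (f : 'rV[R]_n -> R) : Prop :=
  Ck_on 1 A f /\
  (forall v x, A x ->
     exists2 B, nbhs x B & [lipschitz 'd f y v | y in A `&` B]).

(* cmap and cinv are total functions; only their values on cdom and on
   cmap @` cdom matter. *)
Record chart (R : realType) (n : nat) (T : topologicalType) := Chart {
  cdom : set T;
  cmap : T -> 'rV[R]_n;
  cinv : 'rV[R]_n -> T;
  cdom_open : open cdom;
  cran_open : open (cmap @` cdom);
  cmapK : forall q, cdom q -> cinv (cmap q) = q;
  cmap_cont : {within cdom, continuous cmap};
  cinv_cont : {within cmap @` cdom, continuous cinv} }.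

Definition cran (R : realType) n T (a : chart R n T) : set 'rV[R]_n :=
  cmap a @` cdom a.

Definition transition (R : realType) n T (a b : chart R n T) :
  'rV[R]_n -> 'rV[R]_n := cmap b \o cinv a.

(* The atlas need not be maximal. *)
Record smoothManifold (R : realType) (n : nat) := SmoothManifold {
  mspace :> topologicalType;
  mspace_hausdorff : hausdorff_space mspace;
  mspace_second_countable : @second_countable mspace;
  atlas_idx : Type;
  atlas : atlas_idx -> chart R n mspace;
  atlas_cover : forall p, exists i, cdom (atlas i) p;
  atlas_smooth : forall i j,
    smooth_on (cmap (atlas i) @` (cdom (atlas i) `&` cdom (atlas j)))
              (transition (atlas i) (atlas j)) }.

(* A tangent vector at p is the family of its component vectors in the charts
   around p, subject to the transformation law; the components in the charts
   not containing p are set to 0 for uniqueness. *)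
Definition tangent_pred (R : realType) n (M : smoothManifold R n) (p : M) :
    {pred atlas_idx M -> 'rV[R]_n} := fun v => `[<
  (forall i, ~ cdom (atlas i) p -> v i = 0) /\
  (forall i j, cdom (atlas i) p -> cdom (atlas j) p ->
     v j = 'd (transition (atlas i) (atlas j)) (cmap (atlas i) p) (v i)) >].

Lemma tangent_pred_submod (R : realType) n (M : smoothManifold R n) (p : M) :
  submod_closed (tangent_pred p).
Proof.
split.
  by apply/asboolP; split => // i j _ _; rewrite linear0.
move=> k u v /asboolP[u0 uE] /asboolP[v0 vE]; apply/asboolP; split.
  move=> i ni.
  by rewrite /GRing.add/= /GRing.scale/= u0// v0// scaler0 addr0.
move=> i j pi pj.
by rewrite /GRing.add/= /GRing.scale/= (uE _ _ pi pj) (vE _ _ pi pj) linearP.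
Qed.

HB.instance Definition _ (R : realType) n (M : smoothManifold R n) (p : M) :=
  GRing.isSubmodClosed.Build R (atlas_idx M -> 'rV[R]_n) (tangent_pred p)
    (tangent_pred_submod p).

Record tangent (R : realType) n (M : smoothManifold R n) (p : M) := Tangent {
  tcoord : atlas_idx M -> 'rV[R]_n;
  _ : tcoord \in tangent_pred p }.

HB.instance Definition _ (R : realType) n (M : smoothManifold R n) (p : M) :=
  [isSub for @tcoord R n M p].
HB.instance Definition _ (R : realType) n (M : smoothManifold R n) (p : M) :=
  [Choice of tangent p by <:].
HB.instance Definition _ (R : realType) n (M : smoothManifold R n) (p : M) :=
  [SubChoice_isSubLmodule of tangent p by <:].

Section tangent_coordinates.
Context (R : realType) (n : nat) (M : smoothManifold R n).
Implicit Types (a b c : atlas_idx M) (q : M).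

Lemma near_chart a b q : cdom (atlas a) q -> cdom (atlas b) q ->
  \forall x \near cmap (atlas a) q,
    cran (atlas a) x /\ cdom (atlas b) (cinv (atlas a) x).
Proof.
move=> qa qb.
have xa : cran (atlas a) (cmap (atlas a) q) by exists q.
have oa : open (cran (atlas a)) := @cran_open _ _ _ (atlas a).
have /subspace_continuousP /(_ _ xa) /= H := @cinv_cont _ _ _ (atlas a).
have nb : nbhs (cinv (atlas a) (cmap (atlas a) q)) (cdom (atlas b)).
  by rewrite cmapK//; apply: open_nbhs_nbhs; split => //; exact: cdom_open.
have N1 := H _ nb.
have N2 : nbhs (cmap (atlas a) q) (cran (atlas a)) by apply: open_nbhs_nbhs; split.
by apply: filterS2 N2 N1 => x Ax /(_ Ax).
Qed.

Lemma trans_diff a b q : cdom (atlas a) q -> cdom (atlas b) q ->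
  differentiable (transition (atlas a) (atlas b)) (cmap (atlas a) q).
Proof.
move=> qa qb; have [+ _] := @atlas_smooth _ _ M a b 1; apply.
by exists q.
Qed.

Lemma trans_chain a b c q (u : 'rV[R]_n) : cdom (atlas a) q ->
  cdom (atlas b) q -> cdom (atlas c) q ->
  'd (transition (atlas a) (atlas c)) (cmap (atlas a) q) u =
  'd (transition (atlas b) (atlas c)) (cmap (atlas b) q)
     ('d (transition (atlas a) (atlas b)) (cmap (atlas a) q) u).
Proof.
move=> qa qb qc.
have E : transition (atlas a) (atlas b) (cmap (atlas a) q) = cmap (atlas b) q.
  by rewrite /transition /= cmapK.
have dab := trans_diff qa qb.
have dbc : differentiable (transition (atlas b) (atlas c))
   (transition (atlas a) (atlas b) (cmap (atlas a) q)).
  by rewrite E; exact: trans_diff.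
have H := diff_comp dab dbc; rewrite E in H dbc.
transitivity ('d (transition (atlas b) (atlas c) \o transition (atlas a) (atlas b)) (cmap (atlas a) q) u); last first.
  have := congr1 (fun h => h u) H; move=> {}H. exact H.
have dac := trans_diff qa qc.
have dcomp : differentiable (transition (atlas b) (atlas c) \o transition (atlas a) (atlas b)) (cmap (atlas a) q).
  by rewrite -E in dbc; exact: (differentiable_comp dab dbc).
refine (etrans (esym (deriveE u dac)) (etrans _ (deriveE u dcomp))).
apply: near_eq_derive.
apply: filterS (near_chart qa qb) => x [xa xb].
by rewrite /transition /= cmapK.
Qed.

Lemma coord_vec_ex a q (u : 'rV[R]_n) : cdom (atlas a) q ->
  exists v : tangent q, tcoord v a = u.
Proof.
move=> qa.
pose v b := if pselect (cdom (atlas b) q) is left _ then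
  'd (transition (atlas a) (atlas b)) (cmap (atlas a) q) u else 0.
have Pv : v \in tangent_pred q.
  apply/asboolP; split => [i ni|i j qi qj]; rewrite /v.
    by case: pselect.
  case: pselect => // _; case: pselect => // _.
  exact: trans_chain.
exists (Tangent Pv); rewrite /= /v; case: pselect => // _.
refine (etrans (esym (deriveE u (trans_diff qa qa))) _).
have -> : 'D_u (transition (atlas a) (atlas a)) (cmap (atlas a) q) =
          'D_u id (cmap (atlas a) q).
  apply: near_eq_derive; apply: filterS (near_chart qa qa) => x [[r ra <-] _].
  by rewrite /transition/= cmapK.
by rewrite derive_id.
Qed.

Lemma tcoord_inj a q : cdom (atlas a) q -> injective (fun v : tangent q => tcoord v a).
Proof.
move=> qa v w /= E; apply: val_inj; apply/funext => b.
have /asboolP[v0 vE] := valP v; have /asboolP[w0 wE] := valP w.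
have [qb|nb] := pselect (cdom (atlas b) q); last by rewrite v0// w0.
by rewrite (vE _ _ qa qb) (wE _ _ qa qb) /= E.
Qed.
End tangent_coordinates.

(* The i-th coordinate vector of chart a at q: the tangent vector whose
   components in a are those of the i-th basis vector (0 outside cdom a). *)
Definition coord_vec (R : realType) n (M : smoothManifold R n)
    (a : atlas_idx M) (q : M) (i : 'I_n) : tangent q :=
  xget 0 [set v | tcoord v a = delta_mx 0 i].

Lemma coord_vecE (R : realType) n (M : smoothManifold R n)
    (a : atlas_idx M) (q : M) (i : 'I_n) : cdom (atlas a) q ->
  tcoord (coord_vec a q i) a = delta_mx 0 i.
Proof.
move=> qa; rewrite /coord_vec; case: xgetP => [v _ //|] H.
by have [v vE] := coord_vec_ex (delta_mx 0 i) qa; case: (H v vE).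
Qed.

Definition metric_coef (R : realType) n (M : smoothManifold R n)
    (g : forall p : M, tangent p -> tangent p -> R) (a : atlas_idx M)
    (x : 'rV[R]_n) : 'M[R]_n :=
  let q := cinv (atlas a) x in
  \matrix_(i, j) g q (coord_vec a q i) (coord_vec a q j).

(* The signature is that of an orthonormal frame with exactly gindex vectors
   of square -1. *)
Record C11_metric (R : realType) n (M : smoothManifold R n) := C11Metric {
  gform :> forall p : M, tangent p -> tangent p -> R;
  gform_lin : forall (p : M) (k : R) (u v w : tangent p),
    gform (k *: u + v) w = k * gform u w + gform v w;
  gform_sym : forall (p : M) (u v : tangent p), gform u v = gform v u;
  gform_nondeg : forall (p : M) (u : tangent p),
    (forall w, gform u w = 0) -> u = 0;
  gindex : 'I_n.+1;
  gform_signature : forall p : M, exists e : 'I_n -> tangent p,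
    forall i j, gform (e i) (e j) = (-1) ^+ (i < gindex)%N *+ (i == j);
  gform_C11 : forall (a : atlas_idx M) (i j : 'I_n),
    C11_on (cran (atlas a)) (fun x => metric_coef gform a x i j) }.

(* christoffel g a k i j x is Gamma^k_{ij} at the point with coordinates x. *)
Definition christoffel (R : realType) n (M : smoothManifold R n)
    (g : C11_metric M) (a : atlas_idx M) (k i j : 'I_n) (x : 'rV[R]_n) : R :=
  let G := metric_coef g a in
  let pd (m r s : 'I_n) : R := 'D_(delta_mx 0 m) (fun y => G y r s) x in
  2^-1 * \sum_(l < n) invmx (G x) k l * (pd i j l + pd j i l - pd l i j).

Definition geodesic_on (R : realType) n (M : smoothManifold R n)
    (g : C11_metric M) (s t : R) (c : R -> M) : Prop :=
  (forall r, s < r < t -> {for r, continuous c}) /\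
  (forall (a : atlas_idx M) r, s < r < t -> cdom (atlas a) (c r) ->
    let x : R -> 'rV[R]_n := cmap (atlas a) \o c in
    [/\ derivable x r 1, derivable (derive1 x) r 1 &
      forall k : 'I_n, derive1n 2 x r 0 k +
        \sum_(i < n) \sum_(j < n) christoffel g a k i j (x r) *
          derive1 x r 0 i * derive1 x r 0 j = 0]).

Definition has_velocity (R : realType) n (M : smoothManifold R n)
    (c : R -> M) (p : M) (v : tangent p) : Prop :=
  c 0 = p /\
  forall a, cdom (atlas a) p -> derive1 (cmap (atlas a) \o c) 0 = tcoord v a.

(* Geodesics extend past the ends of a compact interval, so existence on [0, 1]
   is existence on an open interval containing [0, 1]. *)
Definition exp_graph (R : realType) n (M : smoothManifold R n)
    (g : C11_metric M) (p : M) (v : tangent p) (q : M) : Prop :=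
  exists c : R -> M, exists s t : R,
    [/\ s < 0, 1 < t, geodesic_on g s t c, has_velocity c v & c 1 = q].

Definition exp_dom (R : realType) n (M : smoothManifold R n)
    (g : C11_metric M) (p : M) : set (tangent p) :=
  [set v | exists q, exp_graph g v q].

(* Total function, meaningful on exp_dom g p. *)
Definition exp_map (R : realType) n (M : smoothManifold R n)
    (g : C11_metric M) (p : M) (v : tangent p) : M :=
  xget p [set q | exp_graph g v q].

Arguments exp_dom {R n M} g p _.
Arguments exp_map {R n M} g p v.

Definition is_norm (R : realType) (E : lmodType R) (N : E -> R) : Prop :=
  [/\ forall u v, N (u + v) <= N u + N v,
      forall k u, N (k *: u) = `|k| * N u &
      forall u, N u = 0 -> u = 0].

Definition norm_open (R : realType) (E : lmodType R) (N : E -> R)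
    (U : set E) : Prop :=
  forall u, U u -> exists2 e : R, 0 < e & forall w, N (w - u) < e -> U w.

Definition homeo_on (R : realType) (E : lmodType R) (N : E -> R)
    (T : topologicalType) (U : set E) (V : set T) (f : E -> T) : Prop :=
  [/\ set_bij U V f,
      forall O : set T, open O -> norm_open N (U `&` f @^-1` O) &
      forall O : set E, norm_open N O -> open (f @` (U `&` O))].

Definition bilipschitz_on (R : realType) (E : lmodType R) (N : E -> R)
    (T : Type) (d : T -> T -> R) (U : set E) (f : E -> T) : Prop :=
  exists c C : R, [/\ 0 < c, 0 < C &
    forall u v, U u -> U v ->
      c * N (u - v) <= d (f u) (f v) <= C * N (u - v)].

(* The library norm on 'rV[R]_n is the sup norm, hence the explicit formula. *)
Definition chart_dist (R : realType) n (M : smoothManifold R n)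
    (a : atlas_idx M) (q r : M) : R :=
  Num.sqrt (\sum_(i < n)
    (cmap (atlas a) q 0 i - cmap (atlas a) r 0 i) ^+ 2).

(* Main.v *)
Require Import Defs.
From HB Require Import structures.
From mathcomp Require Import all_boot all_order all_algebra.
From mathcomp Require Import all_classical all_reals all_analysis.
From mathcomp Require Import ring lra.
Import Order.TTheory GRing.Theory Num.Theory.
Import numFieldNormedType.Exports.
Local Open Scope classical_set_scope.
Local Open Scope ring_scope.
Set Implicit Arguments.
Unset Strict Implicit.
Unset Printing Implicit Defensive.

(* In a chart around p the geodesic equation reads x' = u, u' = F x u with
   F x u = - Gamma_x(u, u), and Gamma is locally Lipschitz because the metric
   is C^{1,1}.  As F is quadratic in u, its Lipschitz constant is as small as
   desired on small velocities, so for small v the fixed-point equation for the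
   velocity u is a contraction on a fixed time interval around [0, 1], and
   comparing two solutions shows that v |-> x_v(1) is a 1/2-Lipschitz
   perturbation of a translation.  Such a map is bi-Lipschitz, and it is open by
   the Banach fixed point theorem.  The curves found in one chart are geodesics
   in every chart because the Christoffel symbols transform with the second
   derivative of the change of coordinates, and comparing two solutions again
   gives the uniqueness of geodesics with given initial velocity. *)

(** * Mean value inequalities and primitives *)

(** The field is merely Lipschitz, so the flow need not be differentiable in the initial velocity
    and the inverse function theorem is out of reach. Its substitute is quantitative: with d the
    difference of the initial velocities, two solutions from one point satisfy |x1(1) - x2(1) - d|
    <= |d| / 2, and a factor below 1 is all that injectivity, openness and both Lipschitz bounds
    require. Two truncations make global statements possible: time is frozen outside [-2, 2], an
    interval with [0, 1] in its interior, and the arguments of the field are clamped; small initial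
    velocities then keep the solution where the clamping is invisible. Two obstacles come from the
    definitions. The geodesic equation is demanded in every chart, hence the transformation law of
    the Christoffel symbols. And [exp_map] selects a point related to v by [exp_graph], so its value
    is known only after uniqueness among all geodesics of M, including those that might leave the
    chart. *)

Section row_norm.
Context {R : realType} {n : nat}.
Implicit Types x y : 'rV[R]_n.

Lemma ler_coord_norm x i : `|x 0 i| <= `|x|.
Proof.
rewrite [leRHS]/Num.norm /= mx_normrE.
exact: (le_bigmax _ (fun ij : 'I_1 * 'I_n => `|x ij.1 ij.2|) (ord0, i)).
Qed.

Lemma row_norm_le x (B : R) : 0 <= B -> (forall i, `|x 0 i| <= B) -> `|x| <= B.
Proof.
move=> B0 xB; rewrite [leLHS]/Num.norm /= mx_normrE.
by apply: bigmax_le => // -[i j] _ /=; rewrite ord1.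
Qed.

Lemma is_derive_rowP (V : normedModType R) (f : V -> 'rV[R]_n) (x v : V) df :
  is_derive x v f df <-> forall i, is_derive x v (fun y : V => f y 0 i) (df 0 i).
Proof.
split=> [[fx <-] i|H].
  have fx' := fx; move/derivable_mxP : fx => /(_ 0 i) fxi.
  by apply: DeriveDef => //; rewrite derive_mx// mxE.
have fx : derivable f x v.
  by apply/derivable_mxP => i j; rewrite ord1; case: (H j).
apply: DeriveDef => //; rewrite derive_mx//; apply/rowP => j; rewrite mxE.
by case: (H j).
Qed.

Lemma real_mean_value (f df : R -> R) (a b B : R) : a <= b ->
  (forall t, a <= t <= b -> is_derive t 1 f (df t)) ->
  (forall t, a <= t <= b -> `|df t| <= B) ->
  `|f b - f a| <= B * (b - a).
Proof.
move=> ab fd dB.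
have [||c cab ->] := @MVT_segment R f df a b ab.
- by move=> t; rewrite in_itv/= => /andP[/ltW at_ /ltW tb]; apply: fd; rewrite at_.
- apply: derivable_within_continuous => t; rewrite in_itv/= => tab.
  by case: (fd _ tab).
rewrite normrM [X in _ * X]ger0_norm ?subr_ge0//.
rewrite ler_wpM2r ?subr_ge0//; apply: dB.
by move: cab; rewrite in_itv.
Qed.

(** The norm is the maximum of the coordinates, so the scalar inequality is applied to each
    coordinate and no dimensional factor enters the constant. *)
Lemma row_mean_value (f df : R -> 'rV[R]_n) (a b B : R) : a <= b ->
  (forall t, a <= t <= b -> is_derive t 1 f (df t)) ->
  (forall t, a <= t <= b -> `|df t| <= B) ->
  `|f b - f a| <= B * (b - a).
Proof.
move=> ab fd dB.
have B0 : 0 <= B by apply: le_trans (dB a _) => //; rewrite lexx.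
apply: row_norm_le => [|i]; first by rewrite mulr_ge0// subr_ge0.
rewrite !mxE; apply: (@real_mean_value (fun s => f s 0 i) (fun s => df s 0 i)) => // t.
  by move=> /fd/is_derive_rowP.
by move=> /dB; apply: le_trans; exact: ler_coord_norm.
Qed.

End row_norm.

Section primitive.
Context {R : realType}.

Lemma primitive_ex (f : R -> R) (c : R) : 0 < c -> continuous f ->
  exists2 P, P 0 = 0 & forall t, - c < t < c -> is_derive t 1 P (f t).
Proof.
move=> c0 cf.
pose F x := (\int[@lebesgue_measure R]_(t in `[- c, x]) f t)%R.
have Fd t : - c < t < c -> is_derive t 1 F (f t).
  move=> /andP[ct tc].
  have ci : (@lebesgue_measure R).-integrable `[- c, c] (EFin \o f).
    apply: continuous_compact_integrable; first exact: segment_compact.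
    by apply: continuous_subspaceT.
  have [dF F'] := continuous_FTC1_closed tc ci ct (cf t).
  by split; [exact: dF|rewrite -(@derive1E _ _ F t)].
exists (fun t => F t - F 0); first by rewrite subrr.
move=> t /Fd Ft; rewrite -[f t]subr0.
exact: is_deriveB.
Qed.

Definition clampr (c t : R) : R := Num.min c (Num.max (- c) t).

Lemma clampr_le (c t : R) : 0 <= c -> `|clampr c t| <= c.
Proof.
move=> c0; rewrite /clampr ler_norml ge_min lexx/= andbT le_min le_max lexx/=.
by rewrite (le_trans _ c0)// oppr_le0.
Qed.

Lemma clampr_id (c t : R) : `|t| <= c -> clampr c t = t.
Proof. by rewrite ler_norml /clampr => /andP[ct tc]; rewrite max_r// min_r. Qed.

Lemma clampr_lipschitz (c s t : R) : `|clampr c s - clampr c t| <= `|s - t|.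
Proof.
rewrite /clampr; set x := Num.max _ s; set y := Num.max _ t.
apply: (@le_trans _ _ `|x - y|).
  case: (leP c x) => ?; case: (leP c y) => ?; rewrite ?subrr ?normr0//;
  case: (ler0P (x - y)) => ?; rewrite ler_norml; apply/andP; split; lra.
rewrite /x /y; case: (leP (- c) s) => ?; case: (leP (- c) t) => ?; rewrite ?subrr ?normr0//;
case: (ler0P (s - t)) => ?; rewrite ler_norml; apply/andP; split; lra.
Qed.

Lemma clampr_continuous (c : R) : continuous (clampr c).
Proof.
move=> t; apply/cvgrPdist_le => e e0; near=> s.
apply: le_trans (clampr_lipschitz _ _ _) _.
near: s; exact: (@cvgr_dist_le _ _ _ _ _ id t cvg_id).
Unshelve. all: by end_near. Qed.

(** The interval exceeds [-2, 2] so that a primitive frozen outside [-2, 2] is still continuous at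
    the two freezing times. *)
Lemma row_primitive3_ex (n : nat) (f : R -> 'rV[R]_n) : continuous f ->
  exists2 P : R -> 'rV[R]_n, P 0 = 0 &
    forall t : R, - 3 < t < 3 -> is_derive t 1 P (f t).
Proof.
move=> cf.
have cfi i : continuous (fun t => f t 0 i).
  move=> t; apply: (@continuous_comp _ _ _ f (fun M : 'rV[R]_n => M 0 i)).
    exact: cf.
  exact: coord_continuous.
have c3 : (0 : R) < 3 by [].
pose Q i := sval (cid2 (primitive_ex c3 (cfi i))).
exists (fun t => \row_i Q i t).
  by apply/rowP => i; rewrite !mxE /Q; case: cid2.
move=> t t3; apply/is_derive_rowP => i.
rewrite (_ : (fun y : R => _) = Q i); last by apply/funext => y; rewrite mxE.
by rewrite /Q; case: cid2 => P /= _; exact.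
Qed.

Lemma clampr_primitive_le (n : nat) (P h : R -> 'rV[R]_n) (B : R) : P 0 = 0 ->
  (forall t : R, - 3 < t < 3 -> is_derive t 1 P (h t)) ->
  (forall t, `|h t| <= B) -> forall t, `|P (clampr 2 t)| <= 2 * B.
Proof.
move=> P0 PD hB t; set s := clampr 2 t.
have B0 : 0 <= B by apply: le_trans (hB 0).
have s2 : - 2 <= s <= 2 by rewrite -ler_norml clampr_le.
have [s0|s0] := leP 0 s.
  have := @row_mean_value _ _ P h 0 s B s0.
  rewrite P0 !subr0 => /(_ _ _)/le_trans; apply => //.
    by move=> r r0; apply: PD; lra.
  by rewrite mulrC ler_wpM2r//; lra.
have := @row_mean_value _ _ P h s 0 B (ltW s0).
rewrite P0 !sub0r normrN => /(_ _ _)/le_trans; apply => //.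
  by move=> r r0; apply: PD; lra.
by rewrite mulrC ler_wpM2r//; lra.
Qed.

(* Primitives are frozen outside [-2, 2], so that sup-norm bounds hold on the whole line. *)
Lemma row_primitive_ex (n : nat) : exists prim : (R -> 'rV[R]_n) -> R -> 'rV[R]_n,
  (forall f : R -> 'rV[R]_n, continuous f ->
    [/\ prim f 0 = 0, continuous (prim f),
      forall t : R, - 2 < t < 2 -> is_derive t 1 (prim f) (f t) &
      forall B, (forall t, `|f t| <= B) -> forall t, `|prim f t| <= 2 * B]) /\
  (forall (f g : R -> 'rV[R]_n) B, continuous f -> continuous g ->
    (forall t, `|f t - g t| <= B) -> forall t, `|prim f t - prim g t| <= 2 * B).
Proof.
(* The default value for discontinuous [f] makes [P] a total operator on curves. *)
pose P (f : R -> 'rV[R]_n) := if pselect (continuous f) is left cf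
  then sval (cid2 (row_primitive3_ex cf)) else (fun=> 0).
have P0 f : P f 0 = 0 by rewrite /P; case: pselect => // cf; case: cid2.
have PD (f : R -> 'rV[R]_n) : continuous f ->
    forall t : R, - 3 < t < 3 -> is_derive t 1 (P f) (f t).
  by move=> cf; rewrite /P; case: pselect => // cf'; case: cid2.
exists (fun f => P f \o clampr 2); split=> [f cf|f g B cf cg fg t]; last first.
  apply: (@clampr_primitive_le _ (P f \- P g) (f \- g)) => //=.
    by rewrite !P0 subrr.
  by move=> s s3; apply: is_deriveB; exact: PD.
split.
- by rewrite /= clampr_id ?normr0.
- move=> t; apply: continuous_comp; first exact: clampr_continuous.
  apply: differentiable_continuous; apply/derivable1_diffP.
  have t2 : - 2 <= clampr 2 t <= 2 by rewrite -ler_norml clampr_le.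
  have t3 : - 3 < clampr 2 t < 3 by lra.
  by case: (PD _ cf _ t3).
- move=> t t2; apply: (@near_eq_is_derive _ _ _ (P f)).
  + near=> s; rewrite /= clampr_id//; apply: ltW; rewrite ltr_norml.
    by near: s; move: t2; exact: near_in_itvoo.
  + by apply: PD => //; lra.
- by move=> B fB t; apply: (@clampr_primitive_le _ (P f) f) => //; exact: PD.
Unshelve. all: by end_near. Qed.

End primitive.

(** * Second-order differential equations with small Lipschitz constant *)

Section contraction.
Context {R : realType}.

Lemma half_expr_lt (D e : R) : 0 < e -> exists k, D / 2 ^+ k < e.
Proof.
move=> e0; have [D0|D0] := leP D 0.
  by exists 0%N; rewrite expr0 divr1 (le_lt_trans D0).
have eD : 0 < e / D by rewrite divr_gt0.
have [k _ Hk] := near_infty_natSinv_expn_lt (PosNum eD).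
have /= := Hk k (leqnn k).
by rewrite ltr_pdivlMr// mulrAC mul1r => ke; exists k.
Qed.

Lemma le0_half_expr (D x : R) : (forall k, x <= D / 2 ^+ k) -> x <= 0.
Proof.
move=> H; rewrite leNgt; apply/negP => /(half_expr_lt D)[k].
by rewrite ltNge H.
Qed.

(** Banach iteration in the sup distance, which is expressed through the bounds [B]. The limit is
    taken pointwise in time; the geometric error bound [fu] is uniform in time, which gives both its
    continuity and the fixed-point equation. *)
Lemma contraction_fixpoint (n : nat) (Phi : (R -> 'rV[R]_n) -> R -> 'rV[R]_n)
    (f0 : R -> 'rV[R]_n) (D : R) :
  continuous f0 ->
  (forall f, continuous f -> continuous (Phi f)) ->
  (forall f g B, continuous f -> continuous g ->
     (forall t, `|f t - g t| <= B) -> forall t, `|Phi f t - Phi g t| <= B / 2) ->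
  (forall t, `|Phi f0 t - f0 t| <= D) ->
  exists2 f : R -> 'rV[R]_n, continuous f & Phi f = f.
Proof.
move=> cf0 cPhi ctr hD.
pose u k := iter k Phi f0.
have cu k : continuous (u k) by elim: k => //= k; exact: cPhi.
have uS k t : `|u k.+1 t - u k t| <= D / 2 ^+ k.
  elim: k t => [|k IH] t; first by rewrite expr0 divr1 hD.
  by rewrite exprSr invfM mulrA; apply: (ctr (u k.+1) (u k)).
(* The right side is the exact partial sum of the geometric series, remainder included, so that the
   induction closes. *)
have uD m k t : `|u (k + m)%N t - u k t| <= D * 2 / 2 ^+ k - D * 2 / 2 ^+ (k + m).
  elim: m => [|m IH]; first by rewrite addn0 !subrr normr0.
  rewrite addnS; have -> : u (k + m).+1 t - u k t =
    (u (k + m).+1 t - u (k + m)%N t) + (u (k + m)%N t - u k t) by rewrite addrA subrK.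
  apply: le_trans (ler_normD _ _) _.
  have := lerD (uS (k + m)%N t) IH; move/le_trans; apply.
  have P0 : (2 : R) ^+ (k + m) != 0 by rewrite expf_neq0.
  have -> : D / 2 ^+ (k + m) = D * 2 / 2 ^+ (k + m) - D * 2 / 2 ^+ (k + m).+1.
    by rewrite exprS; field.
  by rewrite addrC addrA subrK.
have D0 : 0 <= D by apply: le_trans (hD 0).
have uE m k t : (k <= m)%N -> `|u m t - u k t| <= D * 2 / 2 ^+ k.
  move=> km; rewrite -(subnKC km); apply: le_trans (uD _ _ _) _.
  by rewrite gerBl divr_ge0 ?exprn_ge0 ?mulr_ge0.
have cvgu t : cvg (u k t @[k --> \oo]).
  apply/cauchy_cvgP/cauchy_exP => e e0.
  have [k ke] := half_expr_lt (D * 2) e0.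
  exists (u k t); exists k => // m /= km.
  by rewrite -ball_normE /= distrC (le_lt_trans (uE _ _ _ km)).
pose f t : 'rV[R]_n := lim (u k t @[k --> \oo]).
have fu k t : `|f t - u k t| <= D * 2 / 2 ^+ k.
  have : u m t - u k t @[m --> \oo] --> f t - u k t.
    by apply: cvgB; [exact: cvgu|exact: cvg_cst].
  move/cvg_norm => H; rewrite -(cvg_lim _ H)//; apply: limr_le.
    by apply/cvg_ex; eexists; exact: H.
  by exists k => // m /= km; exact: uE.
have cf : continuous f.
  move=> t; apply/cvgrPdist_lt => e e0.
  have e3 : 0 < e / 3 by rewrite divr_gt0.
  have [k ke] := half_expr_lt (D * 2) e3.
  near=> s.
  have -> : f t - f s = (f t - u k t) + (u k t - u k s) + (u k s - f s).
    by rewrite !addrA !subrK.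
  apply: le_lt_trans (ler_normD _ _) _.
  apply: le_lt_trans (lerD (ler_normD _ _) (lexx _)) _.
  rewrite (_ : e = e / 3 + e / 3 + e / 3); last by field.
  apply: ltrD; first apply: ltrD.
  - exact: le_lt_trans (fu _ _) ke.
  - near: s; move/cvgrPdist_lt : (cu k t); exact.
  - by rewrite distrC; exact: le_lt_trans (fu _ _) ke.
exists f => //; apply/funext => t; apply/eqP; rewrite -subr_eq0 -normr_le0.
apply: (@le0_half_expr (D * 2)) => k.
have -> : Phi f t - f t = (Phi f t - u k.+1 t) + (u k.+1 t - f t).
  by rewrite addrA subrK.
apply: le_trans (ler_normD _ _) _.
have h1 := ctr _ _ _ cf (cu k) (fu k) t.
have h2 : `|u k.+1 t - f t| <= D * 2 / 2 ^+ k.+1 by rewrite distrC.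
apply: le_trans (lerD h1 h2) _.
have P0 : (2 : R) ^+ k != 0 by rewrite expf_neq0.
by rewrite exprS le_eqVlt; apply/orP; left; apply/eqP; field.
Unshelve. all: by end_near. Qed.

End contraction.

Section second_order.
Context {R : realType} {n : nat}.
Notation V := 'rV[R]_n.
Variables (F : V -> V -> V) (k : R).
Hypothesis k8 : k <= 8^-1.
Hypothesis FL : forall x y u w B, `|x - y| <= B -> `|u - w| <= B ->
  `|F x u - F y w| <= k * B.

Lemma lipschitz_field_continuous (x u : R -> V) : continuous x -> continuous u ->
  continuous (fun t => F (x t) (u t)).
Proof.
move=> cx cu t; apply/cvgrPdist_le => e e0.
move/cvgrPdist_le : (cx t) => /(_ _ e0) hx.
move/cvgrPdist_le : (cu t) => /(_ _ e0) hu.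
near=> s.
have hB : `|F (x t) (u t) - F (x s) (u s)| <= k * e.
  by apply: FL; near: s.
by apply: le_trans hB _; rewrite ger_pMl// (le_trans k8)// invf_le1// ler1n.
Unshelve. all: by end_near. Qed.

(** Only the velocity is iterated, the position being its primitive. Each primitive on [-2, 2] costs
    a factor 2, once for the position and once for the velocity, so the map contracts by 4 k; this
    is where the threshold 1/8 comes from. *)
Lemma second_order_existence (x0 v : V) (C : R) : (forall x u, `|F x u| <= C) ->
  exists x u : R -> V,
  [/\ x 0 = x0, u 0 = v,
      forall t : R, - 2 < t < 2 ->
        is_derive t 1 x (u t) /\ is_derive t 1 u (F (x t) (u t)) &
      forall t, `|u t - v| <= 2 * C /\ `|x t - x0| <= 2 * (`|v| + 2 * C) ].
Proof.
move=> FC.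
have [prim [primP primB]] := @row_primitive_ex R n.
have primc f : continuous f -> continuous (prim f) by move=> /primP[].
have addc (y : V) (f : R -> V) : continuous f -> continuous (fun t => y + f t).
  by move=> cf t; apply: cvgD; [exact: cvg_cst|exact: cf].
pose X (f : R -> V) t := x0 + prim f t.
pose G (f : R -> V) t := F (X f t) (f t).
pose Phi (f : R -> V) t := v + prim (G f) t.
have cX f : continuous f -> continuous (X f) by move=> /primc; exact: addc.
have cG f : continuous f -> continuous (G f).
  by move=> cf; apply: lipschitz_field_continuous => //; exact: cX.
have [u cu uE] : exists2 f : R -> V, continuous f & Phi f = f.
  apply: (@contraction_fixpoint R n Phi (fun=> v) (2 * C)).
  - by move=> t; exact: cvg_cst.
  - by move=> f cf; apply: addc; apply: primc; exact: cG.
  - move=> f g B cf cg fg t.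
    have B0 : 0 <= B by apply: le_trans (fg 0).
    have h1 s : `|G f s - G g s| <= k * (2 * B).
      apply: FL; last by apply: le_trans (fg _) _; lra.
      by rewrite /X [x0 + _]addrC addrKA; exact: primB.
    rewrite /Phi [v + _]addrC addrKA.
    apply: le_trans (primB _ _ _ (cG _ cf) (cG _ cg) h1 t) _.
    have : k * (4 * B) <= 8^-1 * (4 * B) by rewrite ler_wpM2r// mulr_ge0.
    lra.
  - move=> t; rewrite /Phi addrC addKr.
    by have [_ _ _ ] := primP _ (cG (fun=> v) (fun t => cvg_cst _)); apply => s; exact: FC.
exists (X u), u.
have [p0 _ pD pB] := primP _ (cG _ cu).
have [q0 _ qD qB] := primP _ cu.
have uB t : `|u t - v| <= 2 * C.
  by rewrite -uE /Phi addrC addKr; apply: pB => s; exact: FC.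
split.
- by rewrite /X q0 addr0.
- by rewrite -uE /Phi p0 addr0.
- move=> t t2; split.
    by rewrite -[u t]add0r; apply: is_deriveD; exact: qD.
  by rewrite -{1}uE -[F _ _]add0r; apply: is_deriveD; exact: pD.
- move=> t; split => //; rewrite /X addrC addKr; apply: qB => s.
  by have := ler_normD v (u s - v); rewrite addrC subrK => /le_trans; apply; rewrite lerD2l.
Qed.

(* With B the supremum of |u1 - u2| over [a, b], integrating twice gives
   |u1 - u2 - (u1 a - u2 a)| <= k B, so that B <= 2 |u1 a - u2 a|. *)
Lemma second_order_stability (a b C : R) (x1 u1 x2 u2 : R -> V) : a <= b <= a + 1 ->
  (forall t, a <= t <= b -> is_derive t 1 x1 (u1 t) /\ is_derive t 1 u1 (F (x1 t) (u1 t))) ->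
  (forall t, a <= t <= b -> is_derive t 1 x2 (u2 t) /\ is_derive t 1 u2 (F (x2 t) (u2 t))) ->
  x1 a = x2 a ->
  (forall t, a <= t <= b -> `|u1 t - u2 t| <= C) ->
  forall t, a <= t <= b -> `|u1 t - u2 t| <= 2 * `|u1 a - u2 a| /\
    `|x1 t - x2 t - (t - a) *: (u1 a - u2 a)| <= 2^-1 * `|u1 a - u2 a|.
Proof.
move=> ab D1 D2 xa uC.
have [ab1 ab2] := andP ab.
set d := u1 a - u2 a.
(* The a priori bound [C] makes the supremum finite and then disappears from the estimates. *)
pose S := [set `|u1 t - u2 t| | t in `[a, b]].
have supS : has_sup S.
  split; first by exists `|d|; exists a => //=; rewrite in_itv/= lexx.
  by exists C => _ [t + <-]; rewrite /= in_itv/= => /uC.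
pose B := sup S.
have uB t : a <= t <= b -> `|u1 t - u2 t| <= B.
  by move=> tab; apply: sup_ubound; [case: supS|exists t; rewrite /= ?in_itv].
have B0 : 0 <= B by apply: le_trans (uB a _); rewrite ?lexx.
have xB t : a <= t <= b -> `|x1 t - x2 t| <= B.
  move=> tab; have [at_ tb] := andP tab.
  have := @row_mean_value _ _ (x1 \- x2) (u1 \- u2) a t B at_.
  rewrite /= xa subrr subr0 => /(_ _ _)/le_trans; apply.
  - by move=> s sat; apply: is_deriveB; [apply: (D1 s _).1|apply: (D2 s _).1]; lra.
  - by move=> s sat; apply: uB; lra.
  - by apply: ler_piMr => //; lra.
have ud t : a <= t <= b -> `|u1 t - u2 t - d| <= k * B.
  move=> tab; have [at_ tb] := andP tab.
  (* The sign of [k] is not given: [FL] bounds a norm by [k * B], which is therefore nonnegative. *)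
  have kB0 : 0 <= k * B.
    by apply: le_trans (FL (xB a _) (uB a _)) => //; rewrite lexx.
  have := @row_mean_value _ _ (u1 \- u2) (fun s => F (x1 s) (u1 s) - F (x2 s) (u2 s))
    a t (k * B) at_.
  rewrite /= => /(_ _ _)/le_trans; apply.
  - by move=> s sat; apply: is_deriveB; [apply: (D1 s _).2|apply: (D2 s _).2]; lra.
  - by move=> s sat; apply: FL; [apply: xB|apply: uB]; lra.
  - by apply: ler_piMr => //; lra.
have kB : k * B <= 8^-1 * B by rewrite ler_wpM2r.
have Bd : B <= 2 * `|d|.
  suff : B <= `|d| + k * B by lra.
  apply: ge_sup; first by case: supS.
  move=> _ [t /= + <-]; rewrite in_itv/= => /ud h.
  have := ler_normD d (u1 t - u2 t - d); rewrite addrC subrK => /le_trans; apply.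
  by rewrite lerD2l.
move=> t tab; split; first by apply: le_trans (uB _ tab) _.
have [at_ tb] := andP tab.
have kB0 : 0 <= k * B by apply: le_trans (ud _ tab).
have := @row_mean_value _ _ (fun s => x1 s - x2 s - (s - a) *: d)
  (fun s => u1 s - u2 s - d) a t (k * B) at_.
rewrite /= xa !subrr scale0r !subr0 => /(_ _ _)/le_trans; apply.
- move=> s sat; apply: is_deriveB.
    by apply: is_deriveB; [apply: (D1 s _).1|apply: (D2 s _).1]; lra.
  apply/is_derive_rowP => i.
  have -> : (fun y : R => ((y - a) *: d) 0 i) = (d 0 i) \*: (fun y : R => y - a).
    by apply/funext => y; rewrite !mxE mulrC.
  rewrite -[X in is_derive _ _ _ X]mulr1; apply: is_deriveZ.
  by rewrite -[X in is_derive _ _ _ X]subr0; apply: is_deriveB.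
- by move=> s sat; apply: ud; lra.
- by apply: (@le_trans _ _ (k * B)); [apply: ler_piMr => //; lra|lra].
Qed.


End second_order.

(** * Lipschitz perturbations of the identity *)

(** Completeness of the row space, for the Banach fixed point theorem in [perturbation_open]. *)
HB.instance Definition _ (R : realType) (m n : nat) := Complete.on 'M[R]_(m, n).

Section perturbation.
Context {R : realType} {n : nat}.
Notation V := 'rV[R]_n.
Variables (U : set V) (E : V -> V).
Hypothesis EU : forall v w, U v -> U w ->
  `|E v - E w - (v - w)| <= 2^-1 * `|v - w|.

Lemma perturbation_bilipschitz v w : U v -> U w ->
  2^-1 * `|v - w| <= `|E v - E w| <= 2 * `|v - w|.
Proof.
move=> Uv Uw; have h := EU Uv Uw.
have h1 := ler_normD (E v - E w - (v - w)) (v - w); rewrite subrK in h1.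
have h2 := ler_normD (E v - E w) (- (E v - E w - (v - w))).
rewrite normrN opprB addrCA subrr addr0 in h2.
have := normr_ge0 (v - w).
lra.
Qed.

(** For y near E v, the equation E w = y is the fixed-point equation of w - (E w - y), a contraction
    of factor 1/2. On the closed ball of radius r about v it moves the centre by less than r / 2
    when |y - E v| < r / 2, so it preserves that ball. *)
Lemma perturbation_open (O : set V) : open O -> O `<=` U -> open (E @` O).
Proof.
move=> oO OU; rewrite openE => _ [v Ov <-].
have /nbhs_ballP[s /= s0 sO] : nbhs v O by apply: open_nbhs_nbhs.
pose r := s / 2.
have r0 : 0 < r by rewrite divr_gt0.
pose B := [set w : V | `|w - v| <= r].
have BO : B `<=` O.
  move=> w /= wr; apply: sO; rewrite -ball_normE /= distrC (le_lt_trans wr)//.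
  by rewrite ltr_pdivrMr// ltr_pMr// ltr1n.
have Bv : B v by rewrite /B /= subrr normr0 ltW.
apply/nbhs_ballP; exists (r / 2); first by rewrite /= divr_gt0.
move=> y; rewrite -ball_normE /= => yv.
pose f w := w - (E w - y).
have fB : {homo f : w / B w >-> B w}.
  move=> w Bw; rewrite /B /= /f.
  have -> : w - (E w - y) - v = - (E w - E v - (w - v)) - (E v - y).
    by apply/rowP => i; rewrite !mxE; ring.
  apply: le_trans (ler_normB _ _) _; rewrite normrN.
  have h := EU (OU _ (BO _ Bw)) (OU _ Ov).
  have Bw' : `|w - v| <= r := Bw.
  lra.
have ctr : is_contraction (mkfun_fun fB).
  exists (2^-1%:nng); split; first by rewrite /= invf_lt1// ltr1n.
  move=> [w1 w2] [Bw1 Bw2] /=; rewrite /f.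
  have -> : w1 - (E w1 - y) - (w2 - (E w2 - y)) = - (E w1 - E w2 - (w1 - w2)).
    by apply/rowP => i; rewrite !mxE; ring.
  by rewrite normrN; apply: EU; exact/OU/BO.
have cB : closed B.
  rewrite (_ : B = (fun w => `|w - v|) @^-1` [set x | x <= r])//.
  apply: closed_comp; last exact: closed_le.
  move=> w _; apply: (@cvg_norm _ _ _ (nbhs w)); apply: cvgB; [exact: cvg_id|exact: cvg_cst].
have [w Bw wE] := banach_fixed_point ctr cB (ex_intro _ v Bv).
exists w; first exact: BO.
move: wE; rewrite /= /f => /eqP; rewrite -subr_eq0 opprB addrC subrK subr_eq0.
by move/eqP.
Qed.

End perturbation.

(** * Locally Lipschitz functions *)

Section local_lipschitz.
Context {R : realType} {V : normedModType R}.

(** [K] carries no sign condition; arguments that need a nonnegative constant pass to its absolute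
    value. *)
Definition loclip (x0 : V) (f : V -> R) := exists K, exists2 B, nbhs x0 B &
  forall x y, B x -> B y -> `|f x - f y| <= K * `|x - y|.

Variable x0 : V.
Implicit Types f g : V -> R.

Lemma loclip_bounded f : loclip x0 f -> exists C, exists2 B, nbhs x0 B &
  0 <= C /\ forall x, B x -> `|f x| <= C.
Proof.
move=> [K [B nB fK]].
have Bx : B x0 := nbhs_singleton nB.
exists (`|K| + `|f x0|), (B `&` ball x0 1).
  by apply: filterI => //; exact: nbhsx_ballx.
split=> [|x [xB]]; first by rewrite addr_ge0.
rewrite -ball_normE /= distrC => /ltW x1.
have -> : f x = (f x - f x0) + f x0 by rewrite subrK.
apply: le_trans (ler_normD _ _) _; rewrite lerD2r.
apply: le_trans (fK _ _ xB Bx) _.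
apply: le_trans (ler_norm _) _; rewrite normrM normr_id.
by rewrite ler_piMr.
Qed.

Lemma near_eq_loclip f g : (\forall x \near x0, f x = g x) -> loclip x0 f -> loclip x0 g.
Proof.
move=> fg [K [B nB fK]]; exists K, (B `&` [set x | f x = g x]); first exact: filterI.
by move=> x y [xB /= <-] [yB /= <-]; exact: fK.
Qed.

Lemma loclip_cst (c : R) : loclip x0 (fun=> c).
Proof.
by exists 0, setT => [|x y _ _]; [exact: filterT|rewrite subrr normr0 mul0r].
Qed.

Lemma loclipD f g : loclip x0 f -> loclip x0 g -> loclip x0 (fun x => f x + g x).
Proof.
move=> [K [B nB fK]] [L [D nD gL]]; exists (K + L), (B `&` D); first exact: filterI.
move=> x y [xB xD] [yB yD]; rewrite opprD addrACA mulrDl.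
by apply: le_trans (ler_normD _ _) _; apply: lerD; [exact: fK|exact: gL].
Qed.

Lemma loclipM f g : loclip x0 f -> loclip x0 g -> loclip x0 (fun x => f x * g x).
Proof.
move=> lf lg.
have [C [B' nB' [C0 fC]]] := loclip_bounded lf.
have [C' [D' nD' [C0' gC]]] := loclip_bounded lg.
move: lf lg => [K [B nB fK]] [L [D nD gL]].
exists (C * L + C' * K), (B `&` D `&` (B' `&` D')).
  by apply: filterI; exact: filterI.
move=> x y [[xB xD] [xB' xD']] [[yB yD] [yB' yD']].
have -> : f x * g x - f y * g y = f x * (g x - g y) + g y * (f x - f y) by ring.
apply: le_trans (ler_normD _ _) _; rewrite !normrM mulrDl -!mulrA.
by apply: lerD; apply: ler_pM => //; [exact: fC|exact: gL|exact: gC|exact: fK].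
Qed.

Lemma loclipN f : loclip x0 f -> loclip x0 (fun x => - f x).
Proof.
move=> [K [B nB fK]]; exists K, B => // x y xB yB.
by rewrite -opprD normrN; exact: fK.
Qed.

Lemma loclip_sum (I : Type) (r : seq I) (P : pred I) (F : I -> V -> R) :
  (forall i, loclip x0 (F i)) -> loclip x0 (fun x => \sum_(i <- r | P i) F i x).
Proof.
move=> lF; elim: r => [|i r IH].
  by apply: near_eq_loclip (loclip_cst 0); apply: nearW => x; rewrite big_nil.
have [Pi|Pi] := boolP (P i).
  apply: near_eq_loclip (loclipD (lF i) IH); apply: nearW => x.
  by rewrite big_cons Pi.
by apply: near_eq_loclip IH; apply: nearW => x; rewrite big_cons (negPf Pi).
Qed.

Lemma loclip_prod (I : Type) (r : seq I) (P : pred I) (F : I -> V -> R) :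
  (forall i, loclip x0 (F i)) -> loclip x0 (fun x => \prod_(i <- r | P i) F i x).
Proof.
move=> lF; elim: r => [|i r IH].
  by apply: near_eq_loclip (loclip_cst 1); apply: nearW => x; rewrite big_nil.
have [Pi|Pi] := boolP (P i).
  apply: near_eq_loclip (loclipM (lF i) IH); apply: nearW => x.
  by rewrite big_cons Pi.
by apply: near_eq_loclip IH; apply: nearW => x; rewrite big_cons (negPf Pi).
Qed.

Lemma loclip_continuous f : loclip x0 f -> {for x0, continuous f}.
Proof.
move=> [K [B nB fK]]; apply/cvgrPdist_le => e e0.
have Bx : B x0 := nbhs_singleton nB.
have e' : 0 < e / (`|K| + 1) by rewrite divr_gt0// ltr_wpDl.
near=> x; have Bx' : B x by near: x.
have xe : `|x0 - x| <= e / (`|K| + 1).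
  by near: x; move/cvgrPdist_le : (@cvg_id _ (nbhs x0)); exact.
apply: le_trans (fK _ _ Bx Bx') _.
move: xe; rewrite ler_pdivlMr ?ltr_wpDl// => /le_trans xe; apply: le_trans (xe e _) => //.
rewrite mulrC ler_wpM2l// (le_trans (ler_norm _))// lerDl.
Unshelve. all: by end_near. Qed.

(** Near [x0] the modulus of f stays above half its value at [x0], which bounds the denominator in
    1/f(x) - 1/f(y) = (f(y) - f(x)) / (f(x) f(y)). *)
Lemma loclipV f : f x0 != 0 -> loclip x0 f -> loclip x0 (fun x => (f x)^-1).
Proof.
move=> fx0 lf; have cf := loclip_continuous lf.
have c0 : 0 < `|f x0| / 2 by rewrite divr_gt0// normr_gt0.
have nD : \forall x \near x0, `|f x0| / 2 <= `|f x|.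
  move/cvgrPdist_le : cf => /(_ _ c0); apply: filterS => x xc.
  by have := lerB_dist (f x0) (f x); lra.
move: lf => [K [B nB fK]].
exists ((`|f x0| / 2) ^- 2 * K), (B `&` [set x | `|f x0| / 2 <= `|f x|]).
  exact: filterI.
move=> x y [xB /= xc] [yB /= yc].
have fx : f x != 0 by rewrite -normr_gt0 (lt_le_trans c0).
have fy : f y != 0 by rewrite -normr_gt0 (lt_le_trans c0).
have -> : (f x)^-1 - (f y)^-1 = (f x * f y)^-1 * (f y - f x) by field; rewrite fx fy.
rewrite normrM -mulrA distrC normfV normrM; apply: ler_pM => //.
  by rewrite lef_pV2 ?posrE ?mulr_gt0 ?exprn_gt0 ?normr_gt0// expr2 ler_pM// ltW.
exact: fK.
Qed.

Lemma loclip_det n (G : V -> 'M[R]_n) : (forall i j, loclip x0 (fun x => G x i j)) ->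
  loclip x0 (fun x => \det (G x)).
Proof.
move=> lG; rewrite /determinant; apply: loclip_sum => s; apply: loclipM.
  exact: loclip_cst.
by apply: loclip_prod => i; exact: lG.
Qed.

Lemma loclip_adj n (G : V -> 'M[R]_n) i j : (forall i j, loclip x0 (fun x => G x i j)) ->
  loclip x0 (fun x => (\adj (G x)) i j).
Proof.
move=> lG; have := @loclip_det _ (fun x => row' j (col' i (G x))).
move=> /(_ _) H; apply: near_eq_loclip (loclipM (loclip_cst ((-1) ^+ (j + i))) (H _)).
  by apply: nearW => x; rewrite mxE.
move=> k l; apply: near_eq_loclip (lG (lift j k) (lift i l)).
by apply: nearW => x; rewrite !mxE.
Qed.

(** Cramer's rule: the entries of the inverse are polynomials in the entries of G divided by the
    determinant. The formula for [invmx] holds only where the determinant is nonzero, which by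
    continuity is a neighbourhood of [x0]. *)
Lemma loclip_invmx n (G : V -> 'M[R]_n) i j : (forall i j, loclip x0 (fun x => G x i j)) ->
  G x0 \in unitmx -> loclip x0 (fun x => invmx (G x) i j).
Proof.
move=> lG; rewrite unitmxE unitfE => u0.
have ldet := loclip_det lG.
apply: near_eq_loclip (loclipM (loclipV u0 ldet) (loclip_adj i j lG)).
have : \forall x \near x0, \det (G x) != 0.
  have c0 : 0 < `|\det (G x0)| by rewrite normr_gt0.
  have /cvgrPdist_lt /(_ _ c0) := loclip_continuous ldet.
  apply: filterS => x; apply: contraTneq => ->.
  by rewrite subr0 ltxx.
by apply: filterS => x xu; rewrite /invmx unitmxE unitfE xu [RHS]mxE.
Qed.

End local_lipschitz.

(** * Mean value inequality along segments, and local Lipschitz bounds for C^{1,1} functions *)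

Section calculus.
Context {R : realType}.

Lemma linear_row_sum n (W : lmodType R) (L : {linear 'rV[R]_n -> W}) u :
  L u = \sum_i u 0 i *: L (delta_mx 0 i).
Proof.
by rewrite [in LHS](row_sum_delta u) linear_sum; apply: eq_bigr => i _; rewrite linearZ.
Qed.

Lemma is_derive_curve (V W : normedModType R) (c : R -> V) (f : V -> W) (t : R) dc :
  is_derive t 1 c dc -> differentiable f (c t) ->
  is_derive t 1 (f \o c) ('d f (c t) dc).
Proof.
move=> [/derivable1_diffP cd <-] fd.
have fcd : differentiable (f \o c) t by exact: differentiable_comp.
apply: DeriveDef; first exact/derivable1_diffP.
by rewrite !deriveE// diff_comp.
Qed.

Lemma is_derive_line (V : normedModType R) (x v : V) (t : R) :
  is_derive t 1 (fun s => x + s *: v) v.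
Proof.
have L : differentiable (fun s : R => s *: v) t by exact: differentiableZl.
have D : is_derive t 1 (fun s : R => s *: v) v.
  apply: DeriveDef; first exact/derivable1_diffP.
  have idd : differentiable (id : R -> R) t by [].
  have E := congr1 (fun h => h 1) (@diffZl _ _ _ id v t idd).
  rewrite deriveE// E.
  by rewrite diff_val scale1r.
rewrite -[X in is_derive _ _ _ X]add0r; exact: is_deriveD.
Qed.

Lemma mean_value_le (V : normedModType R) (f : V -> R) (x y : V) (K : R) :
  (forall t : R, 0 <= t <= 1 -> differentiable f (x + t *: (y - x)) /\
     `|'d f (x + t *: (y - x)) (y - x)| <= K) ->
  `|f y - f x| <= K.
Proof.
move=> H; pose c (t : R) := x + t *: (y - x).
have D (t : R) : 0 <= t <= 1 -> is_derive t 1 (f \o c) ('d f (c t) (y - x)).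
  by move=> /H[fd _]; apply: is_derive_curve => //; exact: is_derive_line.
have := @MVT_segment R (f \o c) (fun t => 'd f (c t) (y - x)) 0 1 ler01.
have -> : (f \o c) 1 = f y by rewrite /c /= scale1r addrC subrK.
have -> : (f \o c) 0 = f x by rewrite /c /= scale0r addr0.
case=> [t|/=|t].
- by rewrite in_itv/= => /andP[/ltW t0 /ltW t1]; apply: D; rewrite t0.
- by apply: derivable_within_continuous => t; rewrite in_itv/= => /D[].
- by rewrite in_itv/= => /H[_ +] ->; rewrite subr0 mulr1.
Qed.

Lemma segment_in_ball (V : normedModType R) (x0 x y : V) (e t : R) : 0 <= t <= 1 ->
  ball x0 e x -> ball x0 e y -> ball x0 e (x + t *: (y - x)).
Proof.
rewrite -!ball_normE /= => /andP[t0 t1] xe ye.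
have -> : x0 - (x + t *: (y - x)) = (1 - t) *: (x0 - x) + t *: (x0 - y).
  rewrite opprD addrA -scalerN opprB scalerBl scale1r -[RHS]addrA -scalerN -scalerDr.
  by rewrite opprB addrA subrK.
apply: le_lt_trans (ler_normD _ _) _; rewrite !normrZ.
rewrite (ger0_norm t0) ger0_norm ?subr_ge0//.
have [->|tn1] := eqVneq t 1; first by rewrite subrr mul0r add0r mul1r.
have : (1 - t) * `|x0 - x| < (1 - t) * e by rewrite ltr_pM2l// subr_gt0 lt_neqAle tn1.
have : t * `|x0 - y| <= t * e by rewrite ler_wpM2l// ltW.
lra.
Qed.

(** Locally Lipschitz partial derivatives are bounded on some ball about [x0]; a ball contains the
    segments between its points, so the mean value inequality applies with the sum of these
    bounds. *)
Lemma diff_loclip n (A : set 'rV[R]_n) (f : 'rV[R]_n -> R) (x0 : 'rV[R]_n) :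
  nbhs x0 A -> (forall x, A x -> differentiable f x) ->
  (forall i, loclip x0 (fun x => 'd f x (delta_mx 0 i))) -> loclip x0 f.
Proof.
move=> nA fd lf.
have H i : exists C, \forall x \near x0, `|'d f x (delta_mx 0 i)| <= C.
  have [C [B nB [_ fC]]] := loclip_bounded (lf i).
  by exists C; apply: filterS nB.
pose C i := sval (cid (H i)).
have : \forall x \near x0, A x /\ forall i, `|'d f x (delta_mx 0 i)| <= C i.
  apply: filterI => //.
  pose Q i x := `|'d f x (delta_mx 0 i)| <= C i.
  by apply: (@filter_forall _ _ Q (nbhs x0)) => i; rewrite /Q /C; case: cid.
move=> /nbhs_ballP[e /= e0 eP].
exists (\sum_i C i), (ball x0 e); first exact: nbhsx_ballx.
move=> x y xe ye; apply: mean_value_le => t t1.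
have [At Ct] := eP _ (segment_in_ball t1 ye xe).
split; first exact: fd.
rewrite linear_row_sum mulr_suml; apply: le_trans (ler_norm_sum _ _ _) _.
apply: ler_sum => i _; rewrite normrZ mulrC; apply: ler_pM => //.
exact: ler_coord_norm.
Qed.

Lemma C11_loclip_diff n (A : set 'rV[R]_n) (f : 'rV[R]_n -> R) (x0 v : 'rV[R]_n) :
  open A -> C11_on A f -> A x0 -> loclip x0 (fun x => 'd f x v).
Proof.
(* The library's Lipschitz predicate holds for all constants near infinity, that is, all those above
   [M]; hence the constant [M + 1]. *)
move=> oA [_ /(_ v x0) lf] Ax; have [B nB [M [_ HM]]] := lf Ax.
exists (M + 1), (A `&` B); first by apply: filterI => //; exact: open_nbhs_nbhs.
by move=> x y xB yB; apply: (HM (M + 1) _ (x, y)) => //; rewrite ltrDl.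
Qed.

Lemma C11_loclip n (A : set 'rV[R]_n) (f : 'rV[R]_n -> R) (x0 : 'rV[R]_n) :
  open A -> C11_on A f -> A x0 -> loclip x0 f.
Proof.
move=> oA fA Ax; have [[fd _] _] := fA.
apply: (@diff_loclip _ A) => //; first exact: open_nbhs_nbhs.
by move=> i; exact: C11_loclip_diff fA Ax.
Qed.

Lemma C11_loclip_derive n (A : set 'rV[R]_n) (f : 'rV[R]_n -> R) (x0 v : 'rV[R]_n) :
  open A -> C11_on A f -> A x0 -> loclip x0 (fun x => 'D_v f x).
Proof.
move=> oA fA Ax; have [[fd _] _] := fA.
apply: near_eq_loclip (C11_loclip_diff v oA fA Ax).
have nA : nbhs x0 A by exact: open_nbhs_nbhs.
by apply: filterS nA => x /fd h; rewrite deriveE.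
Qed.

End calculus.

(** * Symmetry of second derivatives *)

Section second_derivative.
Context {R : realType}.

(** The second difference over the parallelogram spanned by s u and s w is s^2 g(x0) up to e s^2.
    The mean value inequality is used twice: along u for [h], whose derivative is a difference of
    [fu], then along w for that difference. *)
Lemma second_difference (V : normedModType R) (f fu g : V -> R) (x0 u w : V) (e : R) :
  0 < e ->
  (\forall x \near x0, differentiable f x /\ 'd f x u = fu x) ->
  (\forall x \near x0, differentiable fu x /\ 'd fu x w = g x) ->
  {for x0, continuous g} ->
  exists2 d, 0 < d & forall s, 0 < s < d ->
   `|f (x0 + s *: u + s *: w) - f (x0 + s *: u) - f (x0 + s *: w) + f x0 -
     s ^+ 2 * g x0| <= e * s ^+ 2.
Proof.
move=> e0 nf nfu cg.
move/cvgrPdist_le : cg => /(_ _ e0) ng.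
have N : \forall x \near x0, (differentiable f x /\ 'd f x u = fu x) /\
    (differentiable fu x /\ 'd fu x w = g x) /\ `|g x0 - g x| <= e.
  by apply: filterI => //; exact: filterI.
move: N => /nbhs_ballP[r /= r0 rP].
have N0 : 0 < `|u| + `|w| + 1 by rewrite ltr_wpDl// addr_ge0.
exists (r / (`|u| + `|w| + 1)); first by rewrite divr_gt0.
move=> s /andP[s0]; rewrite ltr_pdivlMr// => sr.
have inb a b : 0 <= a <= s -> 0 <= b <= s -> ball x0 r (x0 + a *: u + b *: w).
  move=> /andP[a0 as_] /andP[b0 bs].
  rewrite -ball_normE /= -addrA opprD addNKr normrN.
  apply: le_lt_trans (ler_normD _ _) _; rewrite !normrZ !ger0_norm//.
  have : a * `|u| <= s * `|u| by rewrite ler_wpM2r.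
  have : b * `|w| <= s * `|w| by rewrite ler_wpM2r.
  lra.
pose h a := f (x0 + a *: u + s *: w) - f (x0 + a *: u) - a * (s * g x0).
have dlin (c t : R) : is_derive t 1 (fun a => a * c) c.
  have -> : (fun a : R => a * c) = c \*: (id : R -> R).
    by apply/funext => a; rewrite /= mulrC.
  by rewrite -[X in is_derive _ _ _ X]mulr1; exact: is_deriveZ.
have s0' := ltW s0.
have dh a : 0 <= a <= s -> is_derive a 1 h
    (fu (x0 + a *: u + s *: w) - fu (x0 + a *: u) - s * g x0).
  move=> as_; apply: is_deriveB.
  have ss : 0 <= s <= s by rewrite s0' lexx.
  have zz : 0 <= (0 : R) <= s by rewrite lexx.
  apply: is_deriveB.
    have [[fd <-] _] := rP _ (inb _ _ as_ ss).
    apply: is_derive_curve => //.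
    rewrite (_ : (fun a : R => _) = (fun a => (x0 + s *: w) + a *: u)).
      exact: is_derive_line.
    by apply/funext => b; rewrite addrAC.
  have := rP _ (inb _ _ as_ zz); rewrite scale0r addr0 => -[[fd <-] _].
  apply: is_derive_curve => //; exact: is_derive_line.
have bh a : 0 <= a <= s ->
    `|fu (x0 + a *: u + s *: w) - fu (x0 + a *: u) - s * g x0| <= e * s.
  move=> as_; pose k b := fu (x0 + a *: u + b *: w) - b * g x0.
  have := @real_mean_value R k (fun b => g (x0 + a *: u + b *: w) - g x0) 0 s e s0'.
  rewrite /k scale0r addr0 mul0r !subr0 [X in `|X|]addrAC; apply.
    move=> b bs; apply: is_deriveB.
    have [_ [[fd <-] _]] := rP _ (inb _ _ as_ bs).
    apply: is_derive_curve => //; exact: is_derive_line.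
  move=> b bs; have [_ [_ +]] := rP _ (inb _ _ as_ bs).
  by rewrite distrC.
have := @real_mean_value R h _ 0 s (e * s) s0' dh bh.
rewrite /h !scale0r !addr0 mul0r !subr0 expr2 !mulrA.
apply: le_trans; rewrite le_eqVlt; apply/orP; left; apply/eqP; congr `|_|.
by ring.
Qed.

(** The second difference is symmetric in u and w, so both mixed derivatives are its limit after
    division by s^2. *)
Lemma second_derivative_sym (V : normedModType R) (f fu fw guw gwu : V -> R) (x0 u w : V) :
  (\forall x \near x0, [/\ differentiable f x, 'd f x u = fu x & 'd f x w = fw x]) ->
  (\forall x \near x0, differentiable fu x /\ 'd fu x w = guw x) ->
  (\forall x \near x0, differentiable fw x /\ 'd fw x u = gwu x) ->
  {for x0, continuous guw} -> {for x0, continuous gwu} ->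
  guw x0 = gwu x0.
Proof.
move=> nf nfu nfw cu cw.
apply/eqP; rewrite -subr_eq0 -normr_le0; apply/ler_addgt0Pl => e e0; rewrite addr0.
have e2 : 0 < e / 2 by rewrite divr_gt0.
have nf1 : \forall x \near x0, differentiable f x /\ 'd f x u = fu x.
  by apply: filterS nf => x [].
have nf2 : \forall x \near x0, differentiable f x /\ 'd f x w = fw x.
  by apply: filterS nf => x [].
have [d1 d10 H1] := second_difference e2 nf1 nfu cu.
have [d2 d20 H2] := second_difference e2 nf2 nfw cw.
pose s := Num.min d1 d2 / 2.
have m0 : 0 < Num.min d1 d2 by rewrite lt_min d10.
have s0 : 0 < s by rewrite divr_gt0.
have sm : s < Num.min d1 d2 by rewrite /s; lra.
have {}H1 := H1 s; have {}H2 := H2 s.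
rewrite s0 (lt_le_trans sm) ?ge_min ?lexx// in H1.
rewrite s0 (lt_le_trans sm) ?ge_min ?lexx ?orbT// in H2.
have {}H1 := H1 isT; have {}H2 := H2 isT.
have s2 : 0 < s ^+ 2 by rewrite exprn_gt0.
rewrite -(ler_pM2r s2).
have -> : `|guw x0 - gwu x0| * s ^+ 2 = `|s ^+ 2 * guw x0 - s ^+ 2 * gwu x0|.
  by rewrite -mulrBr normrM mulrC [X in _ = X * _]gtr0_norm.
rewrite [x0 + s *: w + s *: u]addrAC in H2.
set D1 := (X in `|X|) in H1; set D2 := (X in `|X|) in H2.
have -> : s ^+ 2 * guw x0 - s ^+ 2 * gwu x0 = D2 - D1 by rewrite /D1 /D2; ring.
apply: le_trans (ler_normB _ _) _.
apply: le_trans (lerD H2 H1) _; lra.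
Qed.

Lemma differentiable_row_coord (V : normedModType R) n (f : V -> 'rV[R]_n) x i :
  differentiable f x -> differentiable (fun y => f y 0 i) x.
Proof.
move=> fd.
apply: (@differentiable_comp _ _ _ _ f (fun M : 'rV[R]_n => M 0 i)) => //.
exact: differentiable_coord.
Qed.

Lemma diff_coord (V : normedModType R) n (f : V -> 'rV[R]_n) x u i : differentiable f x ->
  'd f x u 0 i = 'd (fun y => f y 0 i) x u.
Proof.
move=> fd; have fid := differentiable_row_coord i fd.
by rewrite -!deriveE// derive_mx ?mxE//; exact: diff_derivable.
Qed.

Lemma Ck2_diff_sym n m (A : set 'rV[R]_n) (f : 'rV[R]_n -> 'rV[R]_m) x u w :
  open A -> A x -> Ck_on 2 A f ->
  'd (fun y => 'd f y u) x w = 'd (fun y => 'd f y w) x u.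
Proof.
move=> oA Ax [fd fdd].
have nA : nbhs x A by exact: open_nbhs_nbhs.
apply/rowP => k.
have D v y : A y -> differentiable (fun z => 'd f z v) y by move=> Ay; exact: (fdd v).1.
pose g v z y := 'd (fun y => 'd f y v) y z 0 k.
have nD v z : \forall y \near x, differentiable (fun y => 'd f y v 0 k) y /\
    'd (fun y => 'd f y v 0 k) y z = g v z y.
  apply: filterS nA => y Ay; split; first exact/differentiable_row_coord/D.
  by rewrite /g diff_coord//; exact: D.
have cg v z : {for x, continuous (g v z)}.
  apply: (@continuous_comp _ _ _ (fun y => 'd (fun y => 'd f y v) y z) (fun M : 'rV[R]_m => M 0 k)).
    by have [_ /(_ z)] := fdd v; exact.
  exact: coord_continuous.
apply: (@second_derivative_sym _ (fun y => f y 0 k) (fun y => 'd f y u 0 k)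
  (fun y => 'd f y w 0 k) (g u w) (g w u) x u w) => //.
apply: filterS nA => y /fd fy.
by split; rewrite ?diff_coord//; exact: differentiable_row_coord.
Qed.

End second_derivative.

(** * Product rules *)

Section product_rules.
Context {R : realType} {V : normedModType R}.
Implicit Types (x v : V).

Lemma is_derive_bigsum n (h : 'I_n -> V -> R) dh x v :
  (forall i, is_derive x v (h i) (dh i)) ->
  is_derive x v (fun y => \sum_(i < n) h i y) (\sum_(i < n) dh i).
Proof.
move=> H; rewrite (_ : (fun y => _) = \sum_(i < n) h i); first exact: is_derive_sum.
by apply/funext => y; rewrite fct_sumE.
Qed.

Lemma is_derive_prod (f h : V -> R) df dh x v :
  is_derive x v f df -> is_derive x v h dh ->
  is_derive x v (fun y => f y * h y) (df * h x + f x * dh).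
Proof.
move=> fd hd; have := @is_deriveM _ _ f h x v df dh fd hd.
by rewrite addrC /GRing.scale /= [h x * df]mulrC.
Qed.

Lemma is_derive_bilinear n (U W : V -> 'rV[R]_n) (H : V -> 'M[R]_n) dU dW
    (dH : 'M[R]_n) x v :
  is_derive x v U dU -> is_derive x v W dW ->
  (forall i j, is_derive x v (fun y => H y i j) (dH i j)) ->
  is_derive x v (fun y => (U y *m H y *m (W y)^T) 0 0)
   ((dU *m H x *m (W x)^T) 0 0 + (U x *m dH *m (W x)^T) 0 0 + (U x *m H x *m dW^T) 0 0).
Proof.
move=> /is_derive_rowP Ud /is_derive_rowP Wd Hd.
have E (u w : 'rV[R]_n) (G : 'M[R]_n) :
    (u *m G *m w^T) 0 0 = \sum_j (\sum_i u 0 i * G i j) * w 0 j.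
  by rewrite mxE; apply: eq_bigr => j _; rewrite !mxE.
rewrite (_ : (fun y => _) = fun y => \sum_j (\sum_i U y 0 i * H y i j) * W y 0 j); last first.
  by apply/funext => y; rewrite E.
rewrite !E -!big_split /=.
apply: is_derive_bigsum => j.
rewrite -mulrDl -big_split /=.
apply: is_derive_prod => //; apply: is_derive_bigsum => i.
exact: is_derive_prod.
Qed.

End product_rules.

(** Joint differentiability in base point and direction is avoided by writing u(s) = u(t) + (u(s) -
    u(t)): the first part has a fixed direction, and the second is a finite sum whose coefficients
    vanish at t, so only their derivatives contribute. *)
Lemma is_derive_diff_curve (R : realType) n m (f : 'rV[R]_n -> 'rV[R]_m)
    (x u : R -> 'rV[R]_n) (t : R) dx du :
  (forall w, differentiable (fun y => 'd f y w) (x t)) ->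
  is_derive t 1 x dx -> is_derive t 1 u du ->
  is_derive t 1 (fun s => 'd f (x s) (u s))
    ('d (fun y => 'd f y (u t)) (x t) dx + 'd f (x t) du).
Proof.
move=> fd xd ud.
have -> : (fun s => 'd f (x s) (u s)) =
    (fun s => 'd f (x s) (u t)) \+ (fun s => \sum_i (u s - u t) 0 i *: 'd f (x s) (delta_mx 0 i)).
  by apply/funext => s; rewrite /= -linear_row_sum linearB addrC subrK.
apply: is_deriveD.
  by apply: (@is_derive_curve _ _ _ x (fun y => 'd f y (u t))).
apply/is_derive_rowP => k.
rewrite (_ : (fun s : R => _) =
    fun s => \sum_i (u s - u t) 0 i * 'd f (x s) (delta_mx 0 i) 0 k); last first.
  by apply/funext => s; rewrite summxE; apply: eq_bigr => i _; rewrite mxE.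
have /is_derive_rowP uid := ud.
have -> : ('d f (x t) du) 0 k =
  \sum_i (du 0 i * 'd f (x t) (delta_mx 0 i) 0 k +
    (u t - u t) 0 i * ('d (fun y => 'd f y (delta_mx 0 i)) (x t) dx) 0 k).
  have Lsum : 'd f (x t) du = \sum_i du 0 i *: 'd f (x t) (delta_mx 0 i).
    exact: linear_row_sum.
  refine (etrans (congr1 (fun z : 'rV[R]_m => z 0 k) Lsum) _).
  refine (etrans (summxE _ _ _ _ _) _).
  apply: eq_bigr => i _.
  by rewrite subrr !mxE mul0r addr0.
apply: is_derive_bigsum => i; apply: is_derive_prod.
  rewrite (_ : (fun s : R => _) = (fun s => u s 0 i) \- cst (u t 0 i)).
    by rewrite -[du 0 i]subr0; apply: is_deriveB.
  by apply/funext => s; rewrite !mxE.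
have /is_derive_rowP := @is_derive_curve _ _ _ x (fun y => 'd f y (delta_mx 0 i)) t _ xd (fd _).
exact.
Qed.

(** * The metric in coordinates *)

Section metric_coordinates.
Context {R : realType} {n : nat} {M : smoothManifold R n}.
Implicit Types (a b : atlas_idx M) (q : M).

Lemma tcoord_linear a q : linear (fun v : tangent q => tcoord v a).
Proof. by move=> k u v; rewrite -[tcoord _]/(val (k *: u + v)) linearP. Qed.

Lemma tcoord_sum a q (I : Type) (r : seq I) (c : I -> R) (v : I -> tangent q) :
  tcoord (\sum_(i <- r) c i *: v i) a = \sum_(i <- r) c i *: tcoord (v i) a.
Proof.
elim: r => [|i r IH]; first by rewrite !big_nil.
by rewrite !big_cons tcoord_linear IH.
Qed.

Lemma tcoord_basis a q (v : tangent q) : cdom (atlas a) q ->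
  v = \sum_i tcoord v a 0 i *: coord_vec a q i.
Proof.
move=> qa; apply: (tcoord_inj qa) => /=; rewrite tcoord_sum.
rewrite [LHS]row_sum_delta; apply: eq_bigr => i _.
by rewrite coord_vecE.
Qed.

Lemma tcoord_transition a b q (v : tangent q) : cdom (atlas a) q -> cdom (atlas b) q ->
  tcoord v b = 'd (transition (atlas a) (atlas b)) (cmap (atlas a) q) (tcoord v a).
Proof. by move=> qa qb; have /asboolP[_] := valP v; exact. Qed.

Variable g : C11_metric M.

Lemma gform_suml q (I : Type) (r : seq I) (c : I -> R) (v : I -> tangent q) w :
  g q (\sum_(i <- r) c i *: v i) w = \sum_(i <- r) c i * g q (v i) w.
Proof.
elim: r => [|i r IH]; last by rewrite !big_cons gform_lin IH.
rewrite !big_nil; have := gform_lin g (-1) 0 0 w.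
by rewrite scaler0 addr0 mulN1r addNr.
Qed.

Lemma gform_sumr q (I : Type) (r : seq I) (c : I -> R) (v : I -> tangent q) w :
  g q w (\sum_(i <- r) c i *: v i) = \sum_(i <- r) c i * g q w (v i).
Proof.
by rewrite gform_sym gform_suml; apply: eq_bigr => i _; rewrite gform_sym.
Qed.

Lemma gformE a q (u v : tangent q) : cdom (atlas a) q ->
  g q u v = (tcoord u a *m metric_coef g a (cmap (atlas a) q) *m (tcoord v a)^T) 0 0.
Proof.
move=> qa; rewrite [in LHS](tcoord_basis u qa) [in LHS](tcoord_basis v qa).
rewrite gform_sumr mxE; apply: eq_bigr => j _.
rewrite gform_suml !mxE mulrC; congr (_ * _); apply: eq_bigr => i _.
by rewrite mxE cmapK.
Qed.

Lemma metric_coef_sym a x : (metric_coef g a x)^T = metric_coef g a x.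
Proof. by apply/matrixP => i j; rewrite !mxE gform_sym. Qed.

(** A row in the left kernel is the coordinate row of a tangent vector orthogonal to all others,
    hence zero by nondegeneracy. *)
Lemma metric_coef_unit a x : cran (atlas a) x -> metric_coef g a x \in unitmx.
Proof.
move=> [q qa <-]; rewrite -row_free_unit -kermx_eq0; apply/eqP/row_matrixP => i.
rewrite row0; set u := row i _.
have uG : u *m metric_coef g a (cmap (atlas a) q) = 0.
  by apply/sub_kermxP; rewrite row_sub.
have [v vu] := coord_vec_ex u qa.
have v0 : v = 0.
  by apply: (@gform_nondeg _ _ _ g) => w; rewrite (gformE _ _ qa) vu uG mul0mx mxE.
by rewrite -vu v0.
Qed.

Lemma metric_coef_transition a b q (u w : 'rV[R]_n) :
  cdom (atlas a) q -> cdom (atlas b) q ->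
  let L := 'd (transition (atlas a) (atlas b)) (cmap (atlas a) q) in
  (u *m metric_coef g a (cmap (atlas a) q) *m w^T) 0 0 =
  (L u *m metric_coef g b (cmap (atlas b) q) *m (L w)^T) 0 0.
Proof.
move=> qa qb L.
have [U Uu] := coord_vec_ex u qa; have [W Ww] := coord_vec_ex w qa.
rewrite -Uu -Ww -(gformE U W qa) (gformE U W qb).
by rewrite /L -!tcoord_transition.
Qed.

Definition gamma a (x u : 'rV[R]_n) : 'rV[R]_n :=
  \row_k \sum_i \sum_j christoffel g a k i j x * u 0 i * u 0 j.

Definition dmetric a (x z : 'rV[R]_n) : 'M[R]_n :=
  \matrix_(i, j) 'D_z (fun y => metric_coef g a y i j) x.

Lemma dmetricE a x z i j :
  dmetric a x z i j = 'D_z (fun y => metric_coef g a y i j) x.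
Proof. by rewrite mxE. Qed.

Lemma metric_coef_derivable a x i j : cran (atlas a) x ->
  differentiable (fun y => metric_coef g a y i j) x.
Proof. by move=> xa; have [[+ _] _] := gform_C11 g a i j; apply. Qed.

Lemma dmetric_sum a x z : cran (atlas a) x ->
  dmetric a x z = \sum_m z 0 m *: dmetric a x (delta_mx 0 m).
Proof.
move=> xa; apply/matrixP => i j; rewrite summxE dmetricE deriveE; last exact: metric_coef_derivable.
rewrite linear_row_sum; apply: eq_bigr => m _.
rewrite [RHS]mxE dmetricE deriveE//; exact: metric_coef_derivable.
Qed.

Lemma bilinE (G : 'M[R]_n) (u w : 'rV[R]_n) :
  (u *m G *m w^T) 0 0 = \sum_i \sum_j u 0 i * G i j * w 0 j.
Proof.
rewrite exchange_big mxE; apply: eq_bigr => j _; rewrite !mxE mulr_suml.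
by apply: eq_bigr.
Qed.

(* Koszul formula *)
Lemma gamma_metric a x (u w : 'rV[R]_n) : cran (atlas a) x ->
  (gamma a x u *m metric_coef g a x *m w^T) 0 0 =
  (u *m dmetric a x u *m w^T) 0 0 - 2^-1 * (u *m dmetric a x w *m u^T) 0 0.
Proof.
move=> xa; set G := metric_coef g a x.
pose D m r s := dmetric a x (delta_mx 0 m) r s.
(* The Christoffel symbols of the first kind contracted twice with u; raising the index by the
   inverse metric gives [gamma], so multiplying by the metric recovers [p]. *)
pose p : 'rV[R]_n := \row_l \sum_i \sum_j 2^-1 * (D i j l + D j i l - D l i j) * (u 0 i * u 0 j).
have GT : G^T = G by exact: metric_coef_sym.
have DE m r s : D m r s = 'D_(delta_mx 0 m) (fun y => metric_coef g a y r s) x.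
  exact: dmetricE.
have pE l : p 0 l = \sum_i \sum_j 2^-1 * (D i j l + D j i l - D l i j) * (u 0 i * u 0 j).
  by rewrite mxE.
have chE k i j : christoffel g a k i j x =
    2^-1 * \sum_l invmx G k l * (D i j l + D j i l - D l i j).
  rewrite /christoffel; congr (_ * _); apply: eq_bigr => l _.
  by rewrite !DE.
have dE z r s : dmetric a x z r s = \sum_m z 0 m * D m r s.
  by rewrite (dmetric_sum _ xa) summxE; apply: eq_bigr => m _; rewrite mxE.
clearbody D p.
have invT l k : invmx G l k = invmx G k l by rewrite -{1}GT -trmx_inv mxE.
have gammaE : gamma a x u = p *m invmx G.
  apply/rowP => k; rewrite [RHS]mxE [LHS]mxE.
  under [RHS]eq_bigr do rewrite pE mulr_suml.
  rewrite [RHS]exchange_big /=; apply: eq_bigr => i _.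
  under [RHS]eq_bigr do rewrite mulr_suml.
  rewrite [RHS]exchange_big /=; apply: eq_bigr => j _.
  rewrite chE -mulrA mulr_sumr mulr_suml; apply: eq_bigr => l _.
  by rewrite invT; ring.
rewrite gammaE mulmxKV; last exact: metric_coef_unit.
(* [T y1 y2 y3] is the derivative of the metric along [y1], evaluated on [y2] and [y3]. After
   renaming indices the first two terms of [p] both become [T u u w], the third becomes
   [T w u u]. *)
pose T (y1 y2 y3 : 'rV[R]_n) := \sum_m \sum_i \sum_j y1 0 m * y2 0 i * y3 0 j * D m i j.
have TE y1 y2 y3 : (y2 *m dmetric a x y1 *m y3^T) 0 0 = T y1 y2 y3.
  rewrite bilinE /T [RHS]exchange_big /=; apply: eq_bigr => i _.
  rewrite [RHS]exchange_big /=; apply: eq_bigr => j _.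
  by rewrite dE mulr_sumr mulr_suml; apply: eq_bigr => m _; ring.
rewrite !TE [LHS]mxE.
have -> : \sum_j p 0 j * w^T j 0 =
    2^-1 * (\sum_l \sum_i \sum_j w 0 l * u 0 i * u 0 j * D i j l +
            \sum_l \sum_i \sum_j w 0 l * u 0 i * u 0 j * D j i l -
            \sum_l \sum_i \sum_j w 0 l * u 0 i * u 0 j * D l i j).
  rewrite -big_split -sumrB /= mulr_sumr; apply: eq_bigr => l _.
  rewrite pE mxE -big_split -sumrB /= mulr_sumr mulr_suml; apply: eq_bigr => i _.
  rewrite -big_split -sumrB /= mulr_sumr mulr_suml; apply: eq_bigr => j _.
  ring.
have -> : \sum_l \sum_i \sum_j w 0 l * u 0 i * u 0 j * D i j l = T u u w.
  rewrite /T exchange_big /=; apply: eq_bigr => i _.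
  rewrite exchange_big /=; apply: eq_bigr => j _.
  by apply: eq_bigr => l _; ring.
have -> : \sum_l \sum_i \sum_j w 0 l * u 0 i * u 0 j * D j i l = T u u w.
  rewrite /T exchange_big /=; under eq_bigr do rewrite exchange_big /=.
  rewrite exchange_big /=; apply: eq_bigr => i _; apply: eq_bigr => j _.
  by apply: eq_bigr => l _; ring.
have -> : \sum_l \sum_i \sum_j w 0 l * u 0 i * u 0 j * D l i j = T w u u by [].
by field.
Qed.

End metric_coordinates.

(** * Change of charts *)

Lemma is_derive_diff (R : realType) (V W : normedModType R) (f : V -> W) x v :
  differentiable f x -> is_derive x v f ('d f x v).
Proof. by move=> fd; apply: DeriveDef; [exact: diff_derivable|exact: deriveE]. Qed.

Section change_of_chart.
Context {R : realType} {n : nat} {M : smoothManifold R n}.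
Implicit Types (a b : atlas_idx M) (q : M).

Lemma overlap_open a b :
  open (cmap (atlas a) @` (cdom (atlas a) `&` cdom (atlas b))).
Proof.
rewrite openE => _ [q [qa qb] <-]; rewrite /interior.
apply: filterS (near_chart qa qb) => y [[r ra <-]].
by rewrite cmapK// => rb; exists r.
Qed.

Lemma transition_cmap a b q : cdom (atlas a) q ->
  transition (atlas a) (atlas b) (cmap (atlas a) q) = cmap (atlas b) q.
Proof. by move=> qa; rewrite /transition /= cmapK. Qed.

Variable g : C11_metric M.

Section at_point.
Variables (a b : atlas_idx M) (q : M).
Hypotheses (qa : cdom (atlas a) q) (qb : cdom (atlas b) q).
Let phi := transition (atlas a) (atlas b).
Let x := cmap (atlas a) q.
Let L := 'd phi x.
Let L2 u z := 'd (fun y => 'd phi y u) x z.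

Let Ax : (cmap (atlas a) @` (cdom (atlas a) `&` cdom (atlas b))) x.
Proof. by exists q. Qed.

Lemma transition_diff2 u : differentiable (fun y => 'd phi y u) x.
Proof. by have [_ /(_ u)[+ _]] := @atlas_smooth _ _ M a b 2; apply. Qed.

Let L2C u z : L2 u z = L2 z u.
Proof. have H : Ck_on 2 _ phi := @atlas_smooth _ _ M a b 2.
exact: (Ck2_diff_sym u z (@overlap_open a b) Ax H). Qed.

(** Differentiate the identity g_a(u, w) = g_b(L u, L w) along z, with u and w constant; it holds on
    a neighbourhood of x, where L also varies. *)
Lemma dmetric_transition u w z :
  (u *m dmetric g a x z *m w^T) 0 0 =
  (L2 u z *m metric_coef g b (phi x) *m (L w)^T) 0 0 +
  (L u *m dmetric g b (phi x) (L z) *m (L w)^T) 0 0 +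
  (L u *m metric_coef g b (phi x) *m (L2 w z)^T) 0 0.
Proof.
have phid : differentiable phi x by exact: trans_diff.
have xa : cran (atlas a) x by exists q.
have xb : cran (atlas b) (phi x) by rewrite /phi transition_cmap//; exists q.
have Da : is_derive x z (fun y => (u *m metric_coef g a y *m w^T) 0 0)
    (((0 : 'rV[R]_n) *m metric_coef g a x *m w^T) 0 0 + (u *m dmetric g a x z *m w^T) 0 0
     + (u *m metric_coef g a x *m (0 : 'rV[R]_n)^T) 0 0).
  have H0 := @is_derive_bilinear R _ n (fun=> u) (fun=> w) (metric_coef g a)
    0 0 (dmetric g a x z) x z (is_derive_cst _ _ _) (is_derive_cst _ _ _).
  apply: H0 => i j; rewrite dmetricE; apply: DeriveDef => //.
  by apply: diff_derivable; exact: metric_coef_derivable.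
have Db : is_derive x z (fun y => ('d phi y u *m metric_coef g b (phi y) *m ('d phi y w)^T) 0 0)
  ((L2 u z *m metric_coef g b (phi x) *m (L w)^T) 0 0 +
  (L u *m dmetric g b (phi x) (L z) *m (L w)^T) 0 0 +
  (L u *m metric_coef g b (phi x) *m (L2 w z)^T) 0 0).
  apply: (@is_derive_bilinear _ _ _ (fun y => 'd phi y u) (fun y => 'd phi y w)
    (fun y => metric_coef g b (phi y))).
  - by apply: is_derive_diff; exact: transition_diff2.
  - by apply: is_derive_diff; exact: transition_diff2.
  - move=> i j; have Gd := @metric_coef_derivable _ _ _ g b _ i j xb.
    rewrite dmetricE deriveE// /L.
    have Dc := is_derive_diff z (differentiable_comp phid Gd).
    exact: (is_derive_eq Dc (congr1 (fun h => h z) (diff_comp phid Gd))).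
have E : 'D_z (fun y => (u *m metric_coef g a y *m w^T) 0 0) x =
    'D_z (fun y => ('d phi y u *m metric_coef g b (phi y) *m ('d phi y w)^T) 0 0) x.
  apply: near_eq_derive; apply: filterS (near_chart qa qb) => y [[r ra <-]].
  rewrite cmapK// => rb.
  rewrite (metric_coef_transition g u w ra rb) /phi.
  by rewrite -/(transition (atlas a) (atlas b)) transition_cmap.
move: E; rewrite (@derive_val _ _ _ _ _ _ _ Da) (@derive_val _ _ _ _ _ _ _ Db) => <-.
by rewrite trmx0 mul0mx mulmx0 mul0mx !mxE add0r addr0.
Qed.

(** Both sides are tested against L w through the Koszul formula. Of the second-derivative terms of
    the transition map, only the pairing of [L2 u u] with L w survives: the others cancel by
    symmetry of the second derivative and of the metric. *)
Lemma gamma_transition u :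
  L (gamma g a x u) = gamma g b (phi x) (L u) + L2 u u.
Proof.
have xa : cran (atlas a) x by exists q.
have phix : phi x = cmap (atlas b) q by exact: transition_cmap.
have xb : cran (atlas b) (phi x) by rewrite phix; exists q.
set G := metric_coef g b (phi x).
have GC (s t : 'rV[R]_n) : (s *m G *m t^T) 0 0 = (t *m G *m s^T) 0 0.
  rewrite -[in LHS](trmxK (s *m G *m t^T)) mxE !trmx_mul trmxK.
  by rewrite metric_coef_sym mulmxA.
have key w : (L (gamma g a x u) *m G *m (L w)^T) 0 0 =
    ((gamma g b (phi x) (L u) + L2 u u) *m G *m (L w)^T) 0 0.
  have DR (y1 y2 : 'rV[R]_n) : ((y1 + y2) *m G *m (L w)^T) 0 0 =
      (y1 *m G *m (L w)^T) 0 0 + (y2 *m G *m (L w)^T) 0 0.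
    by rewrite !mulmxDl mxE.
  have alg (X Y A1 A2 B1 B2 c e f h : R) : X = A1 - 2^-1 * A2 -> Y = B1 - 2^-1 * B2 ->
      A1 = c + B1 + e -> A2 = f + B2 + h -> e = h -> f = h -> X = Y + c.
    by move=> -> -> -> -> -> ->; field.
  have TX := metric_coef_transition g (gamma g a x u) w qa qb.
  rewrite /= -phix in TX.
  refine (etrans (esym TX) (etrans _ (esym (DR _ _)))).
  apply: (alg _ _ _ _ _ _ _ _ _ _ (gamma_metric g u w xa) (gamma_metric g (L u) (L w) xb)
    (dmetric_transition u w u) (dmetric_transition u u w)).
    exact: (congr1 (fun y : 'rV[R]_n => (L u *m G *m y^T) 0 0) (L2C w u)).
  exact: GC.
set y1 := L _ in key *; set y2 := _ + L2 u u in key *.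
(* The metric matrix is invertible, and L w takes every basis vector as value, since each is the
   b-component of a tangent vector whose a-component serves as w. *)
apply: (can_inj (mulmxK (metric_coef_unit g xb))); apply/rowP => j.
have [v vj] := coord_vec_ex (delta_mx 0 j) qb.
have := key (tcoord v a); rewrite /L -(tcoord_transition v qa qb) vj trmx_delta.
by rewrite -!colE !mxE.
Qed.

End at_point.
End change_of_chart.

(** * Geodesics in a chart *)

Section geodesics_in_chart.
Context {R : realType} {n : nat} {M : smoothManifold R n} (g : C11_metric M).
Implicit Types (a b : atlas_idx M) (q : M).

Lemma cran_open_chart a : open (cran (atlas a)).
Proof. exact: (@cran_open _ _ _ (atlas a)). Qed.

Lemma cinvK a x : cran (atlas a) x ->
  cdom (atlas a) (cinv (atlas a) x) /\ cmap (atlas a) (cinv (atlas a) x) = x.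
Proof. by move=> [q qa <-]; rewrite cmapK. Qed.

Lemma cinv_comp_continuous a (x : R -> 'rV[R]_n) r : {for r, continuous x} ->
  cran (atlas a) (x r) -> {for r, continuous (cinv (atlas a) \o x)}.
Proof.
move=> cx xa.
have /subspace_continuousP /(_ _ xa) /= H := @cinv_cont _ _ _ (atlas a).
move=> N /H N1.
have {}N1 : \forall y \near x r, cran (atlas a) y -> N (cinv (atlas a) y) := N1.
have N2 : nbhs (x r) (cran (atlas a)).
  by apply: open_nbhs_nbhs; split => //; exact: cran_open_chart.
have C1 := cx _ N1; have C2 := cx _ N2.
have {}C1 : \forall q \near r, cran (atlas a) (x q) -> N (cinv (atlas a) (x q)) := C1.
have {}C2 : \forall q \near r, cran (atlas a) (x q) := C2.
have C3 : \forall q \near r, N (cinv (atlas a) (x q)) by apply: filterS2 C2 C1 => q qa; exact.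
exact: C3.
Qed.

Lemma gamma_transition_at a b (x u : 'rV[R]_n) : cran (atlas a) x ->
  cdom (atlas b) (cinv (atlas a) x) ->
  let phi := transition (atlas a) (atlas b) in
  'd phi x (gamma g a x u) =
  gamma g b (phi x) ('d phi x u) + 'd (fun y => 'd phi y u) x u.
Proof. by move=> [q qa <-]; rewrite cmapK// => qb; exact: gamma_transition. Qed.

Section from_chart.
Variables (a : atlas_idx M) (s t : R) (x u : R -> 'rV[R]_n).
Hypothesis xa : forall r, s < r < t -> cran (atlas a) (x r).
Hypothesis xD : forall r, s < r < t -> is_derive r 1 x (u r).
Let c := cinv (atlas a) \o x.

Lemma chart_curve_continuous r : s < r < t -> {for r, continuous c}.
Proof.
move=> rst; apply: cinv_comp_continuous; last exact: xa.
by apply: differentiable_continuous; apply/derivable1_diffP; case: (xD rst).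
Qed.

Lemma chart_curve_velocity b r : s < r < t -> cdom (atlas b) (c r) ->
  is_derive r 1 (cmap (atlas b) \o c) ('d (transition (atlas a) (atlas b)) (x r) (u r)).
Proof.
move=> rst cb; have [ca xE] := cinvK (xa rst).
have phid : differentiable (transition (atlas a) (atlas b)) (x r).
  by rewrite -xE; exact: trans_diff.
exact: (is_derive_curve (xD rst) phid).
Qed.

Hypothesis uD : forall r, s < r < t -> is_derive r 1 u (- gamma g a (x r) (u r)).

(** In another chart the curve is y = phi(x), so y' = dphi(u) and y'' = d2phi(u, u) -
    dphi(Gamma_a(u, u)); by [gamma_transition] the latter is -Gamma_b(y', y'). *)
Lemma chart_curve_geodesic : geodesic_on g s t c.
Proof.
split=> [r|b r rst cb]; first exact: chart_curve_continuous.
have [ca xE] := cinvK (xa rst).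
set phi := transition (atlas a) (atlas b).
(* The formula for y' is needed on a neighbourhood of r, because it is differentiated once more
   there. *)
have near_r : \forall q \near r, s < q < t /\ cdom (atlas b) (c q).
  apply: filterI; first by move: rst; exact: near_in_itvoo.
  apply: (chart_curve_continuous rst).
  by apply: open_nbhs_nbhs; split => //; exact: cdom_open.
have y1 : \forall q \near r, derive1 (cmap (atlas b) \o c) q = 'd phi (x q) (u q).
  apply: filterS near_r => q [qst qb].
  have := chart_curve_velocity qst qb => H.
  by rewrite derive1E; exact: (@derive_val _ _ _ _ _ _ _ H).
have y2 : is_derive r 1 (derive1 (cmap (atlas b) \o c))
    ('d (fun y => 'd phi y (u r)) (x r) (u r) + 'd phi (x r) (- gamma g a (x r) (u r))).
  have y1' : \forall q \near r, 'd phi (x q) (u q) = derive1 (cmap (atlas b) \o c) q.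
    by apply: filterS y1 => q ->.
  apply: (near_eq_is_derive y1').
  apply: is_derive_diff_curve; [|exact: xD|exact: uD].
  by move=> w; rewrite -xE; exact: transition_diff2.
have [dy1 _] := chart_curve_velocity rst cb.
have [dy2 y2E] := y2.
split; [exact: dy1|exact: dy2|move=> k].
have yr := nbhs_singleton y1.
have /= G := gamma_transition_at (u r) (xa rst) cb.
have Eg : \sum_i \sum_j christoffel g b k i j ((cmap (atlas b) \o c) r) *
      derive1 (cmap (atlas b) \o c) r 0 i * derive1 (cmap (atlas b) \o c) r 0 j =
    gamma g b (phi (x r)) ('d phi (x r) (u r)) 0 k.
  by rewrite yr mxE.
have E2 : derive1n 2 (cmap (atlas b) \o c) r = - gamma g b (phi (x r)) ('d phi (x r) (u r)).
  have alg (A B C D : 'rV[R]_n) : C = - D -> D = B + A -> A + C = - B.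
    by move=> -> ->; rewrite opprD addrCA subrr addr0.
  rewrite derive1nS derive1n1 derive1E.
  exact: (etrans y2E (alg _ _ _ _ (linearN ('d phi (x r)) (gamma g a (x r) (u r))) G)).
refine (etrans (congr2 +%R (congr1 (fun z : 'rV[R]_n => z 0 k) E2) Eg) _).
by rewrite [X in X + _]mxE addNr.
Qed.

Lemma chart_curve_has_velocity p (v : tangent p) : cdom (atlas a) p -> s < 0 < t ->
  x 0 = cmap (atlas a) p -> u 0 = tcoord v a -> has_velocity c v.
Proof.
move=> pa st0 x0 u0.
have c0 : c 0 = p by rewrite /c /= x0 cmapK.
split=> // b pb.
have cb : cdom (atlas b) (c 0) by rewrite c0.
have H := chart_curve_velocity st0 cb.
rewrite derive1E (@derive_val _ _ _ _ _ _ _ H) x0 u0.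
by rewrite (tcoord_transition v pa pb).
Qed.

End from_chart.

Lemma geodesic_chart_ode a (s t r : R) (c : R -> M) : geodesic_on g s t c ->
  s < r < t -> cdom (atlas a) (c r) ->
  let x := cmap (atlas a) \o c in
  is_derive r 1 x (derive1 x r) /\
  is_derive r 1 (derive1 x) (- gamma g a (x r) (derive1 x r)).
Proof.
move=> [_ H] rst ca x; have [d1 d2 E] := H a r rst ca.
split; first by split; [exact: d1|rewrite derive1E].
split; first exact: d2.
have alg (y z : 'rV[R]_n) : (forall k, y 0 k + z 0 k = 0) -> y = - z.
  move=> yz; apply/rowP => k; rewrite [RHS]mxE; apply/eqP.
  by rewrite -addr_eq0; apply/eqP.
apply: alg => k; have := E k; rewrite derive1nS derive1n1 derive1E.
by apply: etrans; congr (_ + _); rewrite mxE.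
Qed.

End geodesics_in_chart.

(** * Local solutions and uniqueness of geodesics *)

Section local_field.
Context {R : realType} {n : nat} {M : smoothManifold R n} (g : C11_metric M).
Variable a : atlas_idx M.
Notation V := 'rV[R]_n.

Lemma christoffel_loclip k i j (x0 : V) : cran (atlas a) x0 ->
  loclip x0 (christoffel g a k i j).
Proof.
move=> xa; have oA := cran_open_chart (a := a).
have lG r s : loclip x0 (fun x => metric_coef g a x r s).
  exact: C11_loclip oA (gform_C11 g a r s) xa.
have lD m r s : loclip x0 (fun x => 'D_(delta_mx 0 m) (fun y => metric_coef g a y r s) x).
  exact: C11_loclip_derive oA (gform_C11 g a r s) xa.
apply: loclipM; first exact: loclip_cst.
apply: loclip_sum => l; apply: loclipM.
  by apply: loclip_invmx => //; exact: metric_coef_unit.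
apply: loclipD; first by apply: loclipD; exact: lD.
by apply: loclipN; exact: lD.
Qed.

(** The bound keeps the powers of the velocities: both terms carry a factor in u and w besides the
    difference, and these factors later make the Lipschitz constant small. *)
Lemma gamma_loclip (x0 : V) : cran (atlas a) x0 -> exists K, exists2 r, 0 < r & 0 <= K /\
  forall x y u w, `|x - x0| < r -> `|y - x0| < r ->
    `|gamma g a x u - gamma g a y w| <=
      K * (`|x - y| * `|u| ^+ 2 + (`|u| + `|w|) * `|u - w|).
Proof.
move=> xa.
have H (k : 'I_n * 'I_n * 'I_n) : exists K, exists2 B, nbhs x0 B & 0 <= K /\
    forall x y, B x -> B y ->
    `|christoffel g a k.1.1 k.1.2 k.2 x| <= K /\
    `|christoffel g a k.1.1 k.1.2 k.2 x - christoffel g a k.1.1 k.1.2 k.2 y| <= K * `|x - y|.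
  have lc := christoffel_loclip k.1.1 k.1.2 k.2 xa.
  have [C [B nB [C0 fC]]] := loclip_bounded lc.
  have [L [D nD fL]] := lc.
  exists (C + `|L|), (B `&` D); first exact: filterI.
  split=> [|x y [xB xD] [yB yD]]; first exact: addr_ge0.
  split; first by apply: le_trans (fC _ xB) _; rewrite lerDl.
  apply: le_trans (fL _ _ xD yD) _; rewrite ler_wpM2r//.
  by apply: le_trans (ler_norm _) _; rewrite lerDr.
pose K k := sval (cid (H k)).
pose B k := s2val (cid2 (svalP (cid (H k)))).
have nB k : nbhs x0 (B k) by rewrite /B; case: cid2.
have KB k : 0 <= K k /\ forall x y, B k x -> B k y ->
    `|christoffel g a k.1.1 k.1.2 k.2 x| <= K k /\
    `|christoffel g a k.1.1 k.1.2 k.2 x - christoffel g a k.1.1 k.1.2 k.2 y| <= K k * `|x - y|.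
  by rewrite /B /K; case: cid2.
have {}nB : \forall x \near x0, forall k, B k x.
  by apply: (@filter_forall _ _ B (nbhs x0)); exact: nB.
move: nB => /nbhs_ballP[r /= r0 rB].
(* Summing over all index triples gives one constant that serves every component of [gamma]. *)
exists (\sum_k K k), r => //; split; first by apply: sumr_ge0 => k _; case: (KB k).
move=> x y u w; rewrite -(distrC x0) -(distrC x0) => xr yr.
have {}xr k : B k x by apply: rB; rewrite -ball_normE.
have {}yr k : B k y by apply: rB; rewrite -ball_normE.
set e := _ + _ * _.
have e0 : 0 <= e by rewrite addr_ge0// mulr_ge0// ?addr_ge0// exprn_ge0.
have S0 : 0 <= (\sum_k K k) * e.
  by rewrite mulr_ge0// sumr_ge0// => k _; case: (KB k).
apply: row_norm_le => // k.
have gE z v : gamma g a z v 0 k = \sum_i \sum_j christoffel g a k i j z * v 0 i * v 0 j.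
  by rewrite mxE.
have tri i j : `|christoffel g a k i j x * u 0 i * u 0 j -
    christoffel g a k i j y * w 0 i * w 0 j| <= K (k, i, j) * e.
  have [K0 /(_ x y (xr _) (yr _))[/= b1 b2]] := KB (k, i, j).
  have [_ /(_ y y (yr _) (yr _))[/= b3 _]] := KB (k, i, j).
  move: (christoffel g a k i j x) (christoffel g a k i j y) b1 b2 b3 => cx cy b1 b2 b3.
  have -> : cx * u 0 i * u 0 j - cy * w 0 i * w 0 j = (cx - cy) * (u 0 i * u 0 j) +
      cy * (u 0 i * (u - w) 0 j + w 0 j * (u - w) 0 i) by rewrite !mxE; ring.
  apply: le_trans (ler_normD _ _) _.
  have -> : K (k, i, j) * e = K (k, i, j) * `|x - y| * `|u| ^+ 2 +
      K (k, i, j) * ((`|u| + `|w|) * `|u - w|) by rewrite /e mulrDr mulrA.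
  apply: lerD.
    rewrite normrM; apply: ler_pM => //.
    by rewrite normrM expr2; apply: ler_pM => //; exact: ler_coord_norm.
  rewrite normrM; apply: ler_pM => //.
  apply: le_trans (ler_normD _ _) _; rewrite mulrDl !normrM.
  by apply: lerD; apply: ler_pM => //; exact: ler_coord_norm.
have -> : (gamma g a x u - gamma g a y w) 0 k = \sum_i \sum_j
   (christoffel g a k i j x * u 0 i * u 0 j - christoffel g a k i j y * w 0 i * w 0 j).
  have -> : (gamma g a x u - gamma g a y w) 0 k = gamma g a x u 0 k - gamma g a y w 0 k.
    by rewrite mxE; congr (_ + _); rewrite mxE.
  rewrite !gE -sumrB; apply: eq_bigr => i _; exact: (esym (sumrB _ _ _ _)).
apply: le_trans (ler_norm_sum _ _ _) _.
apply: (@le_trans _ _ (\sum_i \sum_j K (k, i, j) * e)).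
  apply: ler_sum => i _; apply: le_trans (ler_norm_sum _ _ _) _.
  by apply: ler_sum => j _; exact: tri.
have -> : \sum_i \sum_j K (k, i, j) * e = (\sum_i \sum_j K (k, i, j)) * e.
  by rewrite mulr_suml; apply: eq_bigr => i _; rewrite mulr_suml.
rewrite ler_wpM2r//.
rewrite pair_big /=.
apply: (@le_trans _ _ (\sum_(p : 'I_n * 'I_n) \sum_(k' : 'I_n) K (k', p.1, p.2))).
  apply: ler_sum => p _; rewrite (bigD1 k)//= lerDl sumr_ge0// => k' _.
  by case: (KB (k', p.1, p.2)).
rewrite exchange_big /= pair_big /=.
rewrite le_eqVlt; apply/orP; left; apply/eqP.
rewrite (reindex (fun k : 'I_n * 'I_n * 'I_n => (k.1.1, (k.1.2, k.2)))) /=.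
  by apply: eq_bigr => -[[k1 k2] k3].
by exists (fun k => (k.1, k.2.1, k.2.2)) => [[[? ?] ?]|[? [? ?]]].
Qed.

End local_field.

Section clamp_row.
Context {R : realType} {n : nat}.
Notation V := 'rV[R]_n.

(** Projection onto the closed cube of radius c about [x0], the ball of the sup norm; done
    coordinatewise it is 1-Lipschitz for that norm. *)
Definition clamp_row (x0 : V) (c : R) (x : V) : V :=
  \row_i (x0 0 i + clampr c ((x - x0) 0 i)).

Lemma clamp_row_le x0 c x : 0 <= c -> `|clamp_row x0 c x - x0| <= c.
Proof.
move=> c0; apply: row_norm_le => // i.
have -> : (clamp_row x0 c x - x0) 0 i = clampr c ((x - x0) 0 i).
  by rewrite /clamp_row [LHS]mxE [X in X + _]mxE [X in _ + X]mxE addrC addKr.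
exact: clampr_le.
Qed.

Lemma clamp_row_id x0 c x : `|x - x0| <= c -> clamp_row x0 c x = x.
Proof.
move=> xc; apply/rowP => i; rewrite mxE clampr_id.
  by rewrite !mxE addrCA subrr addr0.
exact: le_trans (ler_coord_norm _ _) xc.
Qed.

Lemma clamp_row_lipschitz x0 c x y : `|clamp_row x0 c x - clamp_row x0 c y| <= `|x - y|.
Proof.
apply: row_norm_le => // i.
have -> : (clamp_row x0 c x - clamp_row x0 c y) 0 i =
    clampr c ((x - x0) 0 i) - clampr c ((y - x0) 0 i).
  by rewrite /clamp_row [LHS]mxE [X in _ + X]mxE !mxE; ring.
apply: le_trans (clampr_lipschitz _ _ _) _.
have -> : (x - x0) 0 i - (y - x0) 0 i = (x - y) 0 i by rewrite !mxE; ring.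
exact: ler_coord_norm.
Qed.

End clamp_row.

(** * The truncated geodesic field and its solutions *)

Section local_flow.
Context {R : realType} {n : nat} {M : smoothManifold R n} (g : C11_metric M).
Variables (a : atlas_idx M) (x0 : 'rV[R]_n).
Hypothesis xa : cran (atlas a) x0.
Notation V := 'rV[R]_n.

Lemma gamma0 x : gamma g a x 0 = 0.
Proof.
apply/rowP => k; rewrite mxE [RHS]mxE big1// => i _; rewrite big1// => j _.
by rewrite [X in _ * _ * X]mxE mulr0.
Qed.

(* F is the field - gamma with both arguments clamped to small cubes, which makes
   it bounded and globally Lipschitz. *)
Lemma local_flow : exists (F : V -> V -> V) (k r s : R),
  [/\ 0 < r, 0 < s, k <= 8^-1,
    forall x y u w B, `|x - y| <= B -> `|u - w| <= B -> `|F x u - F y w| <= k * B &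
    [/\ forall x, `|x - x0| < r -> cran (atlas a) x,
       forall x u, `|x - x0| < r -> `|u| < s -> F x u = - gamma g a x u,
       forall x, F x 0 = 0 &
       forall v, `|v| < s / 2 -> exists x u : R -> V,
         [/\ x 0 = x0, u 0 = v,
          forall t : R, - 2 < t < 2 ->
            is_derive t 1 x (u t) /\ is_derive t 1 u (F (x t) (u t)) &
          forall t, `|u t| < s /\ `|x t - x0| < r]]].
Proof.
have [K [r1 r10 [K0 gK]]] := gamma_loclip g xa.
have nA : nbhs x0 (cran (atlas a)).
  by apply: open_nbhs_nbhs; split => //; exact: cran_open_chart.
move: nA => /nbhs_ballP[r2 /= r20 rA].
pose r := Num.min r1 r2.
have r0 : 0 < r by rewrite lt_min r10.
have rr1 : r <= r1 by rewrite ge_min lexx.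
have rr2 : r <= r2 by rewrite ge_min lexx orbT.
have K1 : 0 < K + 1 by rewrite ltr_wpDl.
(* With s <= 1 and K s <= 1/24, the constant k = K (s^2 + 2 s) is at most 3 K s <= 1/8, and |F| <= K
   s^2 <= s / 24. For |v| < s / 2 the velocity then stays below s / 2 + s / 12 < s and the position
   within 7 s / 6 of [x0], which s <= r / 8 puts below r / 2. *)
pose s := Num.min (r / 8) (Num.min 1 (24 * (K + 1))^-1).
have s0 : 0 < s by rewrite /s !lt_min divr_gt0//= ltr01/= invr_gt0 mulr_gt0.
have sr : s <= r / 8 by rewrite /s ge_min lexx.
have s1 : s <= 1 by rewrite /s !ge_min lexx orbT.
have sK : K * s <= 24^-1.
  have : s <= (24 * (K + 1))^-1 by rewrite /s !ge_min lexx !orbT.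
  by rewrite invfM ler_pdivlMr// => h; lra.
pose F x u := - gamma g a (clamp_row x0 (r / 2) x) (clamp_row 0 s u).
pose k := K * (s ^+ 2 + 2 * s).
have k8 : k <= 8^-1.
  have : K * s * s <= K * s * 1 by rewrite ler_wpM2l// mulr_ge0// ltW.
  by rewrite /k expr2; lra.
have r2' : 0 <= r / 2 by rewrite divr_ge0// ltW.
have cr1 (x : V) : `|clamp_row x0 (r / 2) x - x0| < r1.
  by apply: le_lt_trans (clamp_row_le _ _ r2') _; lra.
have cs (u : V) : `|clamp_row 0 s u| <= s.
  by have := clamp_row_le 0 u (ltW s0); rewrite subr0.
have FL (x y u w : V) (B : R) : `|x - y| <= B -> `|u - w| <= B -> `|F x u - F y w| <= k * B.
  move=> xy uw; rewrite /F -opprD normrN.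
  have B0 : 0 <= B by apply: le_trans xy.
  apply: le_trans (gK _ _ _ _ (cr1 x) (cr1 y)) _.
  rewrite /k -mulrA ler_wpM2l// [leRHS]mulrDl [s ^+ 2 * B]mulrC; apply: lerD.
    apply: ler_pM => //.
      exact: le_trans (clamp_row_lipschitz _ _ _ _) xy.
    by rewrite ler_pXn2r// ?nnegrE// ltW.
  apply: ler_pM => //.
    by have := cs u; have := cs w; lra.
  exact: le_trans (clamp_row_lipschitz _ _ _ _) uw.
have F0 (x : V) : F x 0 = 0.
  by rewrite /F (@clamp_row_id _ _ 0 s 0) ?subrr ?normr0 ?ltW// gamma0 oppr0.
have FC (x u : V) : `|F x u| <= s / 24.
  have := gK _ _ (clamp_row 0 s u) 0 (cr1 x) (cr1 x).
  rewrite gamma0 !subr0 subrr !normr0 mul0r add0r addr0 /F normrN => /le_trans; apply.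
  have : K * (`|clamp_row 0 s u| * `|clamp_row 0 s u|) <= K * (s * s).
    by rewrite ler_wpM2l//; apply: ler_pM.
  have : K * s * s <= 24^-1 * s by rewrite ler_wpM2r// ltW.
  lra.
(* Positions are clamped to radius r / 2 because [gK] requires distances strictly below [r1], while
   the clamped point may lie on the boundary of its cube. *)
exists F, k, (r / 2), s; split => //; first by rewrite divr_gt0.
split => //.
- by move=> x xr; apply: rA; rewrite -ball_normE /= distrC; lra.
- move=> x u xr us; rewrite /F !clamp_row_id ?subr0//; exact: ltW.
- move=> v vs.
  have [x [u [x0E u0E D B]]] := second_order_existence k8 FL x0 v FC.
  exists x, u; split => // t; have [b1 b2] := B t; split.
    by have := ler_normD (u t - v) v; rewrite subrK; lra.
  by lra.
Qed.

End local_flow.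

(** * Uniqueness of geodesics by continuation in time *)

Section uniqueness.
Context {R : realType} {n : nat} {M : smoothManifold R n} (g : C11_metric M).
Notation V := 'rV[R]_n.

Lemma left_limit_eq (T : topologicalType) (f h : R -> T) (t : R) :
  hausdorff_space T -> 0 < t -> {for t, continuous f} -> {for t, continuous h} ->
  (forall q, 0 <= q < t -> f q = h q) -> f t = h t.
Proof.
move=> hT t0 cf ch fh; apply: hT => A B nA nB.
have nfA : \forall q \near t, A (f q) := cf _ nA.
have nhB : \forall q \near t, B (h q) := ch _ nB.
have /nbhs_ballP[e /= e0 eAB] : \forall q \near t, A (f q) /\ B (h q) by exact: filterI.
(* The minimum with t keeps q nonnegative. *)
pose q := t - Num.min t (e / 2).
have m0 : 0 < Num.min t (e / 2) by rewrite lt_min t0 divr_gt0.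
have mt : Num.min t (e / 2) <= t by rewrite ge_min lexx.
have me : Num.min t (e / 2) <= e / 2 by rewrite ge_min lexx orbT.
have [Aq Bq] : A (f q) /\ B (h q).
  apply: eAB; rewrite /ball /= /q opprB addrC subrK gtr0_norm//; lra.
exists (f q); split => //; rewrite fh//; rewrite /q; lra.
Qed.

Variables (a : atlas_idx M) (p : M).
Hypothesis pa : cdom (atlas a) p.
Let x0 := cmap (atlas a) p.
Variables (F : V -> V -> V) (k r s : R).
Hypothesis k8 : k <= 8^-1.
Hypothesis FL : forall x y u w B, `|x - y| <= B -> `|u - w| <= B ->
  `|F x u - F y w| <= k * B.
Hypothesis rA : forall x, `|x - x0| < r -> cran (atlas a) x.
Hypothesis FE : forall x u, `|x - x0| < r -> `|u| < s -> F x u = - gamma g a x u.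
Variables (v : tangent p) (x u : R -> V).
Hypotheses (x0E : x 0 = x0) (u0E : u 0 = tcoord v a).
Hypothesis xuD : forall t : R, - 2 < t < 2 ->
  is_derive t 1 x (u t) /\ is_derive t 1 u (F (x t) (u t)).
Hypothesis xuB : forall t, `|u t| < s /\ `|x t - x0| < r.

Let c := cinv (atlas a) \o x.

Lemma local_exp_graph : exp_graph g v (c 1).
Proof.
have st0 : - 2 < (0 : R) < 2 by lra.
have xa t : - 2 < t < 2 -> cran (atlas a) (x t) by move=> _; apply: rA; case: (xuB t).
have xD (t : R) : - 2 < t < 2 -> is_derive t 1 x (u t) by move=> /xuD[].
exists c, (- 2), 2; split; [lra|lra| | |by []].
  apply: (chart_curve_geodesic xa xD) => t tt; have [_] := xuD tt.
  by rewrite FE//; case: (xuB t).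
exact: (chart_curve_has_velocity xa xD pa st0 x0E u0E).
Qed.

(** Let T be the supremum of the times up to which the two geodesics agree. They agree at T by
    continuity, and if T < 1 the competitor stays for a while in the region where F is the true
    field, so the stability estimate with zero initial difference carries the agreement beyond T. *)
Lemma local_exp_unique (z : M) : exp_graph g v z -> z = c 1.
Proof.
move=> [c' [s' [t' [s0 t1 geo [c'0 c'v] <-]]]].
pose X := cmap (atlas a) \o c'.
have cont_c' t : 0 <= t <= 1 -> {for t, continuous c'}.
  by move=> t01; case: geo => H _; apply: H; lra.
have XD t : 0 <= t <= 1 -> cdom (atlas a) (c' t) ->
    is_derive t 1 X (derive1 X t) /\ is_derive t 1 (derive1 X) (- gamma g a (X t) (derive1 X t)).
  by move=> t01 ct; apply: (geodesic_chart_ode geo) => //; lra.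
have xcont (t : R) : 0 <= t <= 1 -> {for t, continuous x}.
  move=> t01; apply: differentiable_continuous; apply/derivable1_diffP.
  by have [|[]] := xuD (t := t); first lra.
have ucont (t : R) : 0 <= t <= 1 -> {for t, continuous u}.
  move=> t01; apply: differentiable_continuous; apply/derivable1_diffP.
  by have [|_ []] := xuD (t := t); first lra.
have xran t : cran (atlas a) (x t) by apply: rA; case: (xuB t).
have ccont (t : R) : 0 <= t <= 1 -> {for t, continuous c}.
  by move=> t01; exact: (cinv_comp_continuous (xcont t t01) (xran t)).
have cdomc t : cdom (atlas a) (c t) by case: (cinvK (xran t)).
have cmapc t : cmap (atlas a) (c t) = x t by case: (cinvK (xran t)).
(* Points are compared in M, since c' is not known to stay in the chart and [X] has meaning only
   where it does. *)
pose agree t := c' t = c t /\ derive1 X t = u t.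
pose S := [set t : R | 0 <= t <= 1 /\ forall q, 0 <= q <= t -> agree q].
have agree0 : agree 0.
  split; last by rewrite u0E; exact: c'v.
  by rewrite c'0 /c /= x0E cmapK.
have S0 : S 0.
  split; first by rewrite lexx ler01.
  by move=> q; rewrite -eq_le => /eqP <-.
have supS : has_sup S by split; [exists 0|exists 1 => t [/andP[]]].
pose T := sup S.
have T0 : 0 <= T by apply: sup_ubound => //; case: supS.
have T1 : T <= 1 by apply: ge_sup => [|t [/andP[]]//]; exists 0.
have T01 : 0 <= T <= 1 by rewrite T0.
have below q : 0 <= q < T -> agree q.
  move=> /andP[q0 qT]; have e0 : 0 < T - q by rewrite subr_gt0.
  have [t [_ tS]] := sup_adherent e0 supS; rewrite opprB addrC subrK => qt.
  by apply: tS; rewrite q0 ltW.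
have agreeT : agree T.
  have [T0'|T0'] := eqVneq T 0; first by rewrite T0'.
  have Tpos : 0 < T by rewrite lt_neqAle eq_sym T0'.
  (* Positions come first: only once c' T is known to lie in the chart is the velocity of [X] known
     to be continuous at T. *)
  have cT : c' T = c T.
    apply: left_limit_eq => //; [exact: mspace_hausdorff|exact: cont_c'|exact: ccont|].
    by move=> q /below[].
  split; first exact: cT.
  apply: (@left_limit_eq _ (derive1 X) u T (@norm_hausdorff _ _) Tpos); last 2 first.
    exact: ucont.
    by move=> q /below[].
  apply: differentiable_continuous; apply/derivable1_diffP.
  by have [|_ []] := XD _ T01; first by rewrite cT.
have [cT XT] := agreeT.
have cdT : cdom (atlas a) (c' T) by rewrite cT.
have [XT1 XT2] := XD _ T01 cdT.
have XTx : X T = x T by rewrite /X /= cT cmapc.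
have [uT xT] := xuB T.
have [T1'|T1'] := eqVneq T 1; first by rewrite -T1'.
exfalso.
have near1 : \forall t \near T, cdom (atlas a) (c' t).
  by apply: (cont_c' T T01); apply: open_nbhs_nbhs; split => //; exact: cdom_open.
have near2 : \forall t \near T, `|X t - x0| < r.
  have Xc : {for T, continuous X}.
    by apply: differentiable_continuous; apply/derivable1_diffP; case: XT1.
  have d0 : 0 < r - `|x T - x0| by rewrite subr_gt0.
  move/cvgrPdist_lt : Xc => /(_ _ d0); apply: filterS => t; rewrite XTx => ht.
  have := ler_distD (x T) (X t) x0; rewrite (distrC (X t) (x T)); lra.
have near3 : \forall t \near T, `|derive1 X t| < s.
  have Xc : {for T, continuous (derive1 X)}.
    by apply: differentiable_continuous; apply/derivable1_diffP; case: XT2.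
  have d0 : 0 < s - `|u T| by rewrite subr_gt0.
  move/cvgrPdist_lt : Xc => /(_ _ d0); apply: filterS => t; rewrite XT => ht.
  have := ler_normD (u T) (derive1 X t - u T); rewrite addrC subrK distrC; lra.
have /nbhs_ballP[e /= e0 eP] : \forall t \near T,
    cdom (atlas a) (c' t) /\ (`|X t - x0| < r /\ `|derive1 X t| < s).
  by apply: filterI => //; exact: filterI.
(* The step stays inside [0, 1] and inside the neighbourhood of T on which [X] also solves the
   truncated equation. *)
pose d := Num.min (1 - T) (e / 2).
have Tlt1 : 0 < 1 - T by rewrite subr_gt0 lt_neqAle T1'.
have d0 : 0 < d by rewrite lt_min Tlt1 divr_gt0.
have d1 : d <= 1 - T by rewrite ge_min lexx.
have de : d <= e / 2 by rewrite ge_min lexx orbT.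
have inP t : T <= t <= T + d ->
    cdom (atlas a) (c' t) /\ (`|X t - x0| < r /\ `|derive1 X t| < s).
  move=> /andP[Tt tTd]; apply: eP; rewrite /ball /= distrC ger0_norm ?subr_ge0//; lra.
have agreeP t : T <= t <= T + d -> agree t.
  move=> tTd; have [ct _] := inP _ tTd.
  have Td1 : T <= T + d <= T + 1 by lra.
  have D1 q : T <= q <= T + d -> is_derive q 1 X (derive1 X q) /\
      is_derive q 1 (derive1 X) (F (X q) (derive1 X q)).
    move=> qTd; have [cq [Xq dXq]] := inP _ qTd.
    have q01 : 0 <= q <= 1 by lra.
    rewrite (FE Xq dXq); exact: XD.
  have D2 q : T <= q <= T + d -> is_derive q 1 x (u q) /\ is_derive q 1 u (F (x q) (u q)).
    by move=> qTd; apply: xuD; lra.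
  have DB q : T <= q <= T + d -> `|derive1 X q - u q| <= s + s.
    move=> qTd; have [_ [_ dXq]] := inP _ qTd; have [uq _] := xuB q.
    by apply: le_trans (ler_normB _ _) _; lra.
  have := second_order_stability k8 FL Td1 D1 D2 XTx DB tTd.
  rewrite XT subrr scaler0 subr0 normr0 !mulr0 => -[h1 h2].
  have Xt : X t = x t by apply/eqP; rewrite -subr_eq0 -normr_le0.
  split; last by apply/eqP; rewrite -subr_eq0 -normr_le0.
  by rewrite -[LHS](cmapK ct) -[cmap _ _]/(X t) Xt.
have Sb : S (T + d).
  split; first by lra.
  move=> q /andP[q0 qTd]; have [qT|qT] := ltP q T; first by apply: below; rewrite q0.
  by apply: agreeP; rewrite qT.
have : T + d <= T by apply: sup_ubound => //; case: supS.
lra.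
Qed.

End uniqueness.

(** * Equivalence of norms *)

Section norms.
Context {R : realType}.

Lemma is_norm_ge0 (E : lmodType R) (N : E -> R) u : is_norm N -> 0 <= N u.
Proof.
move=> [ND NZ _]; have := ND u (- u); rewrite subrr.
have -> : N (- u) = N u by rewrite -scaleN1r NZ normrN1 mul1r.
have -> : N 0 = 0 by rewrite -(scale0r 0) NZ normr0 mul0r.
by move=> h; lra.
Qed.

Lemma row_norm_equivalence n (N : 'rV[R]_n -> R) : is_norm N ->
  exists c C : R, [/\ 0 < c, 0 < C & forall v, c * `|v| <= N v <= C * `|v|].
Proof.
move=> hN; have [ND NZ N0] := hN.
(* The summand 1 keeps [C] positive in dimension 0. *)
pose C := 1 + \sum_i N (delta_mx 0 i).
have C0 : 0 < C by rewrite ltr_pwDl// sumr_ge0// => i _; exact: is_norm_ge0.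
have NC v : N v <= C * `|v|.
  apply: (@le_trans _ _ (\sum_i N (v 0 i *: delta_mx 0 i))).
    rewrite [in leLHS](row_sum_delta v).
    elim/big_ind2 : _ => [|x1 x2 y1 y2 h1 h2|//].
      by rewrite -(scale0r 0) NZ normr0 mul0r.
    by apply: le_trans (ND _ _) _; exact: lerD.
  apply: (@le_trans _ _ ((\sum_i N (delta_mx 0 i)) * `|v|)).
    rewrite mulr_suml; apply: ler_sum => i _; rewrite NZ mulrC ler_wpM2l ?is_norm_ge0//.
    exact: ler_coord_norm.
  by rewrite ler_wpM2r// lerDr.
have Nc : continuous N.
  move=> v0; apply: loclip_continuous; exists C, setT; first exact: filterT.
  move=> v w _ _.
  have h1 := ND (v - w) w; rewrite subrK in h1.
  have h2 := ND (w - v) v; rewrite subrK in h2.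
  have h3 := NC (v - w); have h4 := NC (w - v); rewrite (distrC w v) in h4.
  by rewrite ler_norml; apply/andP; split; lra.
pose S := [set v : 'rV[R]_n | `|v| = 1].
have sc (v : 'rV[R]_n) : v != 0 -> S (`|v|^-1 *: v).
  by move=> v0; rewrite /S /= normrZ normfV normr_id mulVf// normr_eq0.
(* An empty unit sphere means that every vector is zero; otherwise the lower constant is the minimum
   of N on the compact sphere. *)
have [[s0 Ss0]|S0] := pselect (S !=set0); last first.
  exists 1, C; split => // v; rewrite NC andbT mul1r.
  have [->|v0] := eqVneq v 0; first by rewrite normr0; exact: is_norm_ge0.
  by exfalso; apply: S0; exists (`|v|^-1 *: v); exact: sc.
have cS : compact S.
  apply: bounded_closed_compact.
    by exists 1; split => // x x1 v /= ->; exact: ltW.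
  rewrite (_ : S = (fun v => `|v|) @^-1` [set 1])//.
  by apply: closed_comp => [v _|]; [exact: norm_continuous|exact: closed_eq].
have [m] := @EVT_min_rV R n N S (ex_intro _ s0 Ss0) cS (continuous_subspaceT Nc).
rewrite inE => Sm Nm.
have m0 : 0 < N m.
  rewrite lt_neqAle is_norm_ge0// andbT eq_sym; apply/eqP => /N0 m0.
  by move: Sm; rewrite /S /= m0 normr0 => /eqP; rewrite eq_sym oner_eq0.
exists (N m), C; split => // v; rewrite NC andbT.
have [->|v0] := eqVneq v 0; first by rewrite normr0 mulr0; exact: is_norm_ge0.
have := Nm _ (mem_set (sc _ v0)).
by rewrite NZ normfV normr_id mulrC ler_pdivlMr ?normr_gt0.
Qed.

End norms.

(** The sum of squares is at most n |x|^2; the cruder factor n + 1 avoids a square root and is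
    positive in dimension 0. *)
Lemma euclidean_row_norm (R : realType) n (x : 'rV[R]_n) :
  `|x| <= Num.sqrt (\sum_i x 0 i ^+ 2) <= n.+1%:R * `|x|.
Proof.
have S0 : 0 <= \sum_i x 0 i ^+ 2 by apply: sumr_ge0 => i _; exact: sqr_ge0.
apply/andP; split.
  apply: row_norm_le; first exact: sqrtr_ge0.
  move=> i; rewrite -sqrtr_sqr ler_sqrt// (bigD1 i)//= lerDl.
  by apply: sumr_ge0 => j _; exact: sqr_ge0.
have r0 : 0 <= n.+1%:R * `|x| by rewrite mulr_ge0.
rewrite -[leRHS]ger0_norm// -sqrtr_sqr ler_sqrt ?sqr_ge0//.
apply: (@le_trans _ _ (\sum_(i < n) `|x| ^+ 2)).
  apply: ler_sum => i _; rewrite -[leLHS]ger0_norm ?sqr_ge0// normrX.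
  by rewrite ler_pXn2r// ?nnegrE// ler_coord_norm.
rewrite sumr_const card_ord -[leLHS]mulr_natl exprMn ler_wpM2r ?sqr_ge0//.
by rewrite -natrX ler_nat (leq_trans (leqnSn n))// leq_pmulr.
Qed.

(** * Norms and neighbourhoods read in a chart *)

Section tangent_norm.
Context {R : realType} {n : nat} {M : smoothManifold R n}.

Lemma tangent_norm_equivalence (a : atlas_idx M) (p : M) (N : tangent p -> R) :
  cdom (atlas a) p -> is_norm N ->
  exists c C : R, [/\ 0 < c, 0 < C &
    forall v, c * `|tcoord v a| <= N v <= C * `|tcoord v a| ].
Proof.
move=> pa [ND NZ N0].
pose T (u : 'rV[R]_n) : tangent p := sval (cid (coord_vec_ex u pa)).
have TK u : tcoord (T u) a = u by rewrite /T; case: cid.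
have KT v : T (tcoord v a) = v by apply: (tcoord_inj pa); rewrite /= TK.
have TL k u v : T (k *: u + v) = k *: T u + T v.
  apply: (tcoord_inj pa).
  refine (etrans (TK _) (esym (etrans (tcoord_linear a k (T u) (T v)) _))).
  by rewrite !TK.
have NT : is_norm (N \o T).
  have T0 : T 0 = 0 by have := TL (-1) 0 0; rewrite scaler0 addr0 scaleN1r addNr.
  split => /=.
  - by move=> u v; have := TL 1 u v; rewrite !scale1r => ->; exact: ND.
  - by move=> k u; have := TL k u 0; rewrite !addr0 T0 addr0 => ->; exact: NZ.
  - by move=> u /N0 Tu; rewrite -(TK u) Tu -T0 TK.
have [c [C [c0 C0 H]]] := row_norm_equivalence NT.
by exists c, C; split => // v; have := H (tcoord v a); rewrite /= KT.
Qed.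

Lemma tcoordB (a : atlas_idx M) (p : M) (u v : tangent p) :
  tcoord (u - v) a = tcoord u a - tcoord v a.
Proof.
by have H := tcoord_linear a (-1) v u; rewrite !scaleN1r in H; rewrite [u - v]addrC H addrC.
Qed.

Lemma chart_preimage_open (a : atlas_idx M) (W : set 'rV[R]_n) : open W ->
  open (cdom (atlas a) `&` cmap (atlas a) @^-1` W).
Proof.
move=> oW; rewrite openE => q [qa Wq].
have /subspace_continuousP /(_ _ qa) /= H := @cmap_cont _ _ _ (atlas a).
have nW : nbhs (cmap (atlas a) q) W by exact: open_nbhs_nbhs.
have N1 : \forall z \near q, cdom (atlas a) z -> W (cmap (atlas a) z) := H _ nW.
have N2 : \forall z \near q, cdom (atlas a) z.
  by apply: open_nbhs_nbhs; split => //; exact: cdom_open.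
have : \forall z \near q, cdom (atlas a) z /\ W (cmap (atlas a) z).
  by apply: filterS2 N2 N1 => z za Hz; split => //; exact: Hz.
exact.
Qed.

Lemma cinv_preimage_nbhs (a : atlas_idx M) (x : 'rV[R]_n) (O : set M) : open O ->
  cran (atlas a) x -> O (cinv (atlas a) x) ->
  exists2 d, 0 < d & forall y, `|y - x| < d -> cran (atlas a) y -> O (cinv (atlas a) y).
Proof.
move=> oO xa Ox.
have /subspace_continuousP /(_ _ xa) /= H := @cinv_cont _ _ _ (atlas a).
have nO : nbhs (cinv (atlas a) x) O by exact: open_nbhs_nbhs.
have N1 : \forall y \near x, cran (atlas a) y -> O (cinv (atlas a) y) := H _ nO.
move: N1 => /nbhs_ballP[d /= d0 dP]; exists d => // y yd; apply: dP.
by rewrite -ball_normE /= distrC.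
Qed.

End tangent_norm.

(** * The exponential map on a small ball *)

Theorem theorem2p1 (R : realType) (n : nat) (M : smoothManifold R n)
    (g : C11_metric M) (p : M)
    (N : tangent p -> R) (hN : is_norm N)
    (a : atlas_idx M) (ha : cdom (atlas a) p) :
  exists (U : set (tangent p)) (V : set M),
    (norm_open N U /\ U 0) /\
    (open V /\ V p /\ V `<=` cdom (atlas a)) /\
    U `<=` exp_dom g p /\
    homeo_on N U V (exp_map g p) /\
    bilipschitz_on N (chart_dist a) U (exp_map g p).
Proof.
pose x0 := cmap (atlas a) p.
have x0a : cran (atlas a) x0 by exists p.
have [F [k [r [s [r0 s0 k8 FL [rA FE F0 flow]]]]]] := local_flow g x0a.
pose B0 := [set v : 'rV[R]_n | `|v| < s / 2].
(* The premise [B0 v] sits inside the relation so that a solution can be chosen for every v, with a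
   dummy pair outside the ball. *)
pose P (v : 'rV[R]_n) (xu : (R -> 'rV[R]_n) * (R -> 'rV[R]_n)) : Prop := B0 v ->
    [/\ xu.1 0 = x0, xu.2 0 = v,
      forall t : R, - 2 < t < 2 -> is_derive t 1 xu.1 (xu.2 t) /\
        is_derive t 1 xu.2 (F (xu.1 t) (xu.2 t)) &
      forall t, `|xu.2 t| < s /\ `|xu.1 t - x0| < r].
have /choice[X XP] v : exists xu, P v xu.
  have [vB|] := pselect (B0 v); last by exists (fun=> 0, fun=> 0).
  by have [x [u H]] := flow v vB; exists (x, u).
pose E v := (X v).1 1.
have ab01 : (0 : R) <= (1 : R) <= (0 : R) + (1 : R) by lra.
have in01 : (0 : R) <= (1 : R) <= (1 : R) by lra.
have EB v w : B0 v -> B0 w -> `|E v - E w - (v - w)| <= 2^-1 * `|v - w|.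
  move=> /XP[xv uv Dv Bv] /XP[xw uw Dw Bw].
  have := @second_order_stability R n F k k8 FL 0 1 (s + s) (X v).1 (X v).2 (X w).1 (X w).2 ab01.
  move=> /(_ _ _ _ _ _ in01)[].
  - by move=> t t01; apply: Dv; lra.
  - by move=> t t01; apply: Dw; lra.
  - by rewrite xv xw.
  - move=> t _; have [b1 _] := Bv t; have [b2 _] := Bw t.
    by apply: le_trans (ler_normB _ _) _; lra.
  - by move=> _; rewrite subr0 scale1r uv uw.
have B00 : B0 0 by rewrite /B0 /= normr0 divr_gt0.
(* The chosen solution with zero velocity is compared with the constant curve, a solution because
   [F x 0 = 0]. *)
have E0 : E 0 = x0.
  have [xv uv Dv Bv] := XP _ B00.
  have := @second_order_stability R n F k k8 FL 0 1 s (X 0).1 (X 0).2 (fun=> x0) (fun=> 0) ab01.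
  move=> /(_ _ _ _ _ _ in01)[].
  - by move=> t t01; apply: Dv; lra.
  - move=> t _; rewrite F0; split; exact: is_derive_cst.
  - by rewrite xv.
  - by move=> t _; rewrite subr0; have [b1 _] := Bv t; exact: ltW.
  - by move=> _; rewrite uv subrr scaler0 subr0 normr0 mulr0 normr_le0 subr_eq0 => /eqP.
have Eran v : B0 v -> cran (atlas a) (E v).
  by move=> /XP[_ _ _ Bv]; apply: rA; case: (Bv 1).
have graph (w : tangent p) : B0 (tcoord w a) -> exp_graph g w (cinv (atlas a) (E (tcoord w a))).
  by move=> /XP[xv uv Dv Bv]; exact: (local_exp_graph ha rA FE xv uv Dv Bv).
have expE (w : tangent p) : B0 (tcoord w a) -> exp_map g p w = cinv (atlas a) (E (tcoord w a)).
  move=> wB; apply: xget_unique; first exact: graph.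
  move=> z; have [xv uv Dv Bv] := XP _ wB.
  exact: (local_exp_unique ha k8 FL rA FE xv uv Dv Bv).
have cexp (w : tangent p) : B0 (tcoord w a) ->
    cdom (atlas a) (exp_map g p w) /\ cmap (atlas a) (exp_map g p w) = E (tcoord w a).
  by move=> wB; rewrite expE//; exact/cinvK/Eran.
have [c [C [c0 C0 NE]]] := tangent_norm_equivalence ha hN.
have NB (u w : tangent p) :
    c * `|tcoord u a - tcoord w a| <= N (u - w) <= C * `|tcoord u a - tcoord w a|.
  by rewrite -tcoordB; exact: NE.
pose U := [set w : tangent p | B0 (tcoord w a)].
(* Writing the image as a preimage under the chart turns openness in M into openness of the image of
   [B0] under E. *)
pose V := cdom (atlas a) `&` cmap (atlas a) @^-1` (E @` B0).
have oB0 : open B0.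
  rewrite (_ : B0 = ball 0 (s / 2)); first exact: ball_open.
  by apply/funext => v; rewrite -ball_normE /B0 /= sub0r normrN.
have imO (O : set (tangent p)) : exp_map g p @` (U `&` O) =
    cdom (atlas a) `&` cmap (atlas a) @^-1`
      (E @` [set v | B0 v /\ exists2 w, O w & tcoord w a = v]).
  apply/seteqP; split=> [_ [w [wU Ow] <-]|q [qa [v [vB [w Ow wv]] vq]]].
    have [wa wE] := cexp _ wU; split => //.
    by exists (tcoord w a) => //; split => //; exists w.
  exists w; first by split; rewrite /U /= ?wv.
  by rewrite expE wv// vq cmapK.
have T0 : tcoord (0 : tangent p) a = 0 by rewrite -(subrr 0) tcoordB subrr.
exists U, V; split; [|split; [|split; [|split]]].
- split; last by have := B00; rewrite -T0.
  move=> u uU; have u0 : 0 < s / 2 - `|tcoord u a| by rewrite subr_gt0.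
  exists (c * (s / 2 - `|tcoord u a|)); first exact: mulr_gt0.
  move=> w; have /andP[h _] := NB w u => /(le_lt_trans h); rewrite ltr_pM2l// => hw.
  by have := ler_normD (tcoord w a - tcoord u a) (tcoord u a); rewrite subrK /U /B0 /=; lra.
- split; first exact/chart_preimage_open/(perturbation_open EB oB0).
  split; last by move=> q [].
  by split => //; exists 0.
- by move=> w wU; exists (cinv (atlas a) (E (tcoord w a))); exact: graph.
- split.
  + split.
    * by move=> w wU; have [wa wE] := cexp _ wU; split => //; exists (tcoord w a).
    * move=> u w /set_mem uU /set_mem wU uw; apply: (tcoord_inj ha) => /=.
      have [_ uE] := cexp _ uU; have [_ wE] := cexp _ wU.
      have := perturbation_bilipschitz EB uU wU; rewrite -uE -wE uw subrr normr0.
      move=> /andP[h _]; apply/eqP; rewrite -subr_eq0 -normr_le0; lra.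
    * move=> q [qa [v vB vq]]; have [w wv] := coord_vec_ex v ha.
      by exists w; rewrite ?/U /= ?wv// expE wv// vq cmapK.
  + move=> O oO u [uU Ou].
    have := Ou; rewrite /= expE// => Ou'.
    have [d d0 dP] := cinv_preimage_nbhs oO (Eran _ uU) Ou'.
    have u0 : 0 < s / 2 - `|tcoord u a| by rewrite subr_gt0.
    (* The first bound keeps w in the ball; the half in the second offsets the Lipschitz constant 2
       of E. *)
    pose e := Num.min (s / 2 - `|tcoord u a|) (d / 2).
    have e0 : 0 < e by rewrite lt_min u0 divr_gt0.
    have e1 : e <= s / 2 - `|tcoord u a| by rewrite ge_min lexx.
    have e2 : e <= d / 2 by rewrite ge_min lexx orbT.
    exists (c * e); first exact: mulr_gt0.
    move=> w; have /andP[h _] := NB w u => /(le_lt_trans h); rewrite ltr_pM2l// => hw.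
    have wU : B0 (tcoord w a).
      by have := ler_normD (tcoord w a - tcoord u a) (tcoord u a); rewrite subrK /B0 /=; lra.
    split => //; rewrite /= expE//; apply: dP; last exact: Eran.
    by have /andP[_] := perturbation_bilipschitz EB wU uU; lra.
  + move=> O oO; rewrite imO; apply/chart_preimage_open/(perturbation_open EB); last by move=> v [].
    rewrite openE => v [vB [w Ow wv]].
    have [e e0 eO] := oO _ Ow.
    have v0 : 0 < s / 2 - `|v| by rewrite subr_gt0.
    (* Dividing by C converts a coordinate distance below e / C into an N-distance below e. *)
    apply/nbhs_ballP; exists (Num.min (s / 2 - `|v|) (e / C)).
      by rewrite /= lt_min v0 divr_gt0.
    move=> y; rewrite -ball_normE /= distrC lt_min => /andP[y1 y2]; split.
      by have := ler_normD (y - v) v; rewrite subrK /B0 /=; lra.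
    have [z zy] := coord_vec_ex y ha; exists z => //; apply: eO.
    have /andP[_ h] := NB z w; apply: le_lt_trans h _.
    by rewrite zy wv mulrC -ltr_pdivlMr.
(* E distorts the sup norm by factors between 1/2 and 2, N compares with it through c and C, and the
   Euclidean distance exceeds it by at most the factor n + 1. *)
- exists ((2 * C)^-1), (2 * n.+1%:R / c); split.
  + by rewrite invr_gt0 mulr_gt0.
  + by rewrite divr_gt0// mulr_gt0.
  + move=> u w uU wU.
    have [_ uE] := cexp _ uU; have [_ wE] := cexp _ wU.
    have -> : chart_dist a (exp_map g p u) (exp_map g p w) =
        Num.sqrt (\sum_i (E (tcoord u a) - E (tcoord w a)) 0 i ^+ 2).
      by rewrite /chart_dist uE wE; congr Num.sqrt; apply: eq_bigr => i _; rewrite !mxE.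
    have /andP[h1 h2] := euclidean_row_norm (E (tcoord u a) - E (tcoord w a)).
    have /andP[h3 h4] := perturbation_bilipschitz EB uU wU.
    have /andP[h5 h6] := NB u w.
    apply/andP; split.
      apply: le_trans h1; apply: le_trans h3.
      by rewrite invfM -mulrA ler_pM2l ?invr_gt0// mulrC ler_pdivrMr// mulrC.
    apply: le_trans h2 _; rewrite mulrAC ler_pdivlMr//.
    apply: (@le_trans _ _ (n.+1%:R * (2 * `|tcoord u a - tcoord w a|) * c)).
      by rewrite ler_wpM2r ?(ltW c0)// ler_wpM2l.
    have -> : n.+1%:R * (2 * `|tcoord u a - tcoord w a|) * c =
      2 * n.+1%:R * (c * `|tcoord u a - tcoord w a|) by ring.
    by rewrite ler_wpM2l.
Qed.
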